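(* Let $\Gamma$ be a discrete semigroup and $(\mathsf C_i)_{i\in I}$ a countable family of idempotent classes of $\Gamma$-systems. Then every $\Gamma$-system $\mathbf X_0$ admits an extension $\pi:\mathbf X\to\mathbf X_0$ such that (i) $\mathbf X$ is $\mathsf C_i$-sated for every $i\in I$, and (ii) the factor $\pi$ together with the maximal $\mathsf C_i$-factors $\zeta^{\mathbf X}_{\mathsf C_i}$, $i\in I$, generate the whole $\sigma$-algebra of $\mathbf X$ modulo null sets.
   Context: A $\Gamma$-system $\mathbf X=(X,\Sigma,\mu,T)$ is a standard Borel probability space with an action of $\Gamma$ by measurable $\mu$-preserving maps. A factor map $\pi:\mathbf X\to\mathbf Y=(Y,\Phi,\nu,S)$ is a measurable map with $\pi_\#\mu=\nu$ and $S^\gamma\circ\pi=\pi\circ T^\gamma$ for all $\gamma$; an extension of $\mathbf Y$ is a system with a factor map onto $\mathbf Y$. A joining of systems $\mathbf X_1,\dots,\mathbf X_k$ is a system with factor maps to each $\mathbf X_i$ whose pulled-back $\sigma$-algebras together generate its $\sigma$-algebra (mod null sets). A class $\mathsf C$ of $\Gamma$-systems is idempotent if it contains the trivial (one-point) system and is closed under isomorphism, joinings and inverse limits (of inverse sequences of factor maps). For such $\mathsf C$ every system $\mathbf X$ has an essentially unique maximal factor lying in $\mathsf C$ (the largest invariant $\sigma$-subalgebra generated by a factor map to a member of $\mathsf C$); $\zeta^{\mathbf X}_{\mathsf C}$ denotes a factor map coordinatizing it. $\mathbf X$ is $\mathsf C$-sated if for every extension $\pi:\tilde{\mathbf X}=(\tilde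 X,\tilde\Sigma,\tilde\mu,\tilde T)\to\mathbf X$, the $\sigma$-algebras generated by $\pi$ and by $\zeta^{\tilde{\mathbf X}}_{\mathsf C}$ are relatively independent under $\tilde\mu$ over the $\sigma$-algebra generated by $\zeta^{\mathbf X}_{\mathsf C}\circ\pi$; i.e. $\mathsf E_{\tilde\mu}(f\circ\pi\mid\zeta^{\tilde{\mathbf X}}_{\mathsf C})=\mathsf E_\mu(f\mid\zeta^{\mathbf X}_{\mathsf C})\circ\pi$ for all $f\in L^\infty(\mu)$. *)

(* Defs.v *)
From HB Require Import structures.
From mathcomp Require Import all_boot all_order all_algebra.
From mathcomp Require Import all_classical all_reals all_analysis.

Unset Printing Implicit Defensive.

Import Order.TTheory GRing.Theory Num.Theory.

Local Open Scope classical_set_scope.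
Local Open Scope ring_scope.

Record semigroup := Semigroup {
  sg_car :> Type;
  sg_op : sg_car -> sg_car -> sg_car;
  sg_assoc : forall a b c, sg_op a (sg_op b c) = sg_op (sg_op a b) c }.

(* Standard Borel space: measurably isomorphic to a Borel subset of R
   (Kuratowski's characterization). Borel sets of R = measurableTypeR R. *)
Definition standard_borel (R : realType) {d} (T : measurableType d) : Prop :=
  exists (A : set (measurableTypeR R)) (f : T -> measurableTypeR R)
         (g : measurableTypeR R -> T),
    measurable A /\ measurable_fun setT f /\ measurable_fun A g /\
    (forall x, A (f x)) /\ (forall x, g (f x) = x) /\
    (forall y, A y -> f (g y) = y).

Record system (R : realType) (G : semigroup) := System {
  sys_d : measure_display;
  sys_T : measurableType sys_d;
  sys_mu : probability sys_T R;
  sys_act : G -> sys_T -> sys_T;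
  sys_std : standard_borel R sys_T;
  sys_act_meas : forall g, measurable_fun setT (sys_act g);
  sys_act_pres : forall g (A : set sys_T), measurable A ->
      sys_mu (sys_act g @^-1` A) = sys_mu A;
  sys_act_comp : forall g h x,
      sys_act (sg_op G g h) x = sys_act g (sys_act h x) }.

Arguments sys_T {R G}.
Arguments sys_mu {R G}.
Arguments sys_act {R G}.
Arguments sys_d {R G}.

Section defs.
Context {R : realType} {G : semigroup}.
Local Notation system := (system R G).

Definition factor_map (X Y : system) (pi : sys_T X -> sys_T Y) : Prop :=
  measurable_fun setT pi /\
  (forall B : set (sys_T Y), measurable B ->
      sys_mu X (pi @^-1` B) = sys_mu Y B) /\
  (forall g x, sys_act Y g (pi x) = pi (sys_act X g x)).

Arguments factor_map {X Y}.

Definition isomorphic (X Y : system) : Prop :=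
  exists (f : sys_T X -> sys_T Y) (g : sys_T Y -> sys_T X),
    factor_map f /\ factor_map g /\ cancel f g /\ cancel g f.

Definition pullback (X Y : system) (pi : sys_T X -> sys_T Y)
  : set (set (sys_T X)) :=
  [set pi @^-1` B | B in [set B : set (sys_T Y) | measurable B]].

Arguments pullback {X Y}.

Definition symdiff T (A B : set T) := (A `\` B) `|` (B `\` A).

Arguments symdiff {T}.

Definition generates_mod0 (X : system) (F : set (set (sys_T X))) : Prop :=
  forall A : set (sys_T X), measurable A ->
    exists B, <<s F >> B /\ sys_mu X (symdiff A B) = 0%E.

Definition joining_of (k : nat) (Xs : 'I_k -> system) (Z : system)
  (p : forall i, sys_T Z -> sys_T (Xs i)) : Prop :=
  (forall i, factor_map (p i)) /\
  generates_mod0 Z (\bigcup_i pullback (p i)).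

Arguments joining_of {k Xs Z}.

Definition inverse_limit_of (Xs : nat -> system)
  (psi : forall n, sys_T (Xs n.+1) -> sys_T (Xs n)) (Z : system)
  (phi : forall n, sys_T Z -> sys_T (Xs n)) : Prop :=
  (forall n, factor_map (psi n)) /\
  (forall n, factor_map (phi n)) /\
  (forall n x, psi n (phi n.+1 x) = phi n x) /\
  generates_mod0 Z (\bigcup_n pullback (phi n)).

Arguments inverse_limit_of {Xs} psi {Z}.

Definition idempotent_class (C : system -> Prop) : Prop :=
  (exists X : system, C X /\ forall x y : sys_T X, x = y) /\
  (forall X Y : system, C X -> isomorphic X Y -> C Y) /\
  (forall (k : nat) (Xs : 'I_k -> system) (Z : system)
      (p : forall i, sys_T Z -> sys_T (Xs i)),
      (0 < k)%N -> (forall i, C (Xs i)) -> joining_of p -> C Z) /\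
  (forall (Xs : nat -> system)
      (psi : forall n, sys_T (Xs n.+1) -> sys_T (Xs n)) (Z : system)
      (phi : forall n, sys_T Z -> sys_T (Xs n)),
      (forall n, C (Xs n)) -> inverse_limit_of psi phi -> C Z).

(* The maximal C-factor sigma-algebra of X (completed inside the measurable
   sets): measurable sets a.e. equal to a set pulled back by some factor map
   onto a member of C. *)
Definition max_factor (C : system -> Prop) (X : system)
  : set (set (sys_T X)) :=
  [set A | measurable A /\
     exists (Y : system) (zeta : sys_T X -> sys_T Y),
       C Y /\ factor_map zeta /\
       exists B : set (sys_T Y), measurable B /\
         sys_mu X (symdiff A (zeta @^-1` B)) = 0%E].

Definition F_measurable (X : system) (F : set (set (sys_T X)))
  (g : sys_T X -> measurableTypeR R) : Prop :=
  forall B : set (measurableTypeR R), measurable B -> F (g @^-1` B).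

Definition cond_exp_version (X : system) (F : set (set (sys_T X)))
  (f g : sys_T X -> measurableTypeR R) : Prop :=
  F_measurable X F g /\
  (sys_mu X).-integrable setT (EFin \o g) /\
  forall A, F A ->
    (\int[sys_mu X]_(x in A) (g x)%:E = \int[sys_mu X]_(x in A) (f x)%:E)%E.

Definition bounded_measurable (X : system)
  (f : sys_T X -> measurableTypeR R) : Prop :=
  measurable_fun setT f /\ exists M : R, forall x, `|f x| <= M.

Arguments bounded_measurable {X}.

Definition sated (C : system -> Prop) (X : system) : Prop :=
  forall (Xt : system) (pi : sys_T Xt -> sys_T X), factor_map pi ->
  forall f : sys_T X -> measurableTypeR R, bounded_measurable f ->
  exists g : sys_T X -> measurableTypeR R,
    cond_exp_version X (max_factor C X) f g /\
    cond_exp_version Xt (max_factor C Xt) (f \o pi) (g \o pi).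

End defs.
Arguments factor_map {R G X Y}.
Arguments isomorphic {R G}.
Arguments pullback {R G X Y}.
Arguments symdiff {T}.
Arguments generates_mod0 {R G}.
Arguments joining_of {R G k Xs Z}.
Arguments inverse_limit_of {R G Xs} psi {Z}.
Arguments idempotent_class {R G}.
Arguments max_factor {R G}.
Arguments F_measurable {R G}.
Arguments cond_exp_version {R G}.
Arguments bounded_measurable {R G X}.
Arguments sated {R G}.

(* Main.v *)
From HB Require Import structures.
From mathcomp Require Import all_boot all_order all_algebra.
From mathcomp Require Import all_classical all_reals all_analysis.
From mathcomp Require Import measurable_realfun.
From mathcomp Require Import ring lra.
Require Import Defs.

(** For a bounded function [f] on [X], consider the [L^2]-distance from [f] to
    the functions that factor through a member of [C]. Lifting [f] to an
    extension can only decrease it. If no extension decreases it, the best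
    approximation [g] of [f] on [X] stays a best approximation on every
    extension, so that there the residual of [f] is orthogonal to all functions
    that factor through [C], and [g] lifts to the conditional expectation: this
    is satedness.

    Start from [X0]. At step [n], pick a pair [(i, s)], where [s] describes a
    cylinder of the current system, take an extension and a factor of it in
    [C i] approximating the indicator of the cylinder within [1/(n+1)] of the
    best possible over all extensions, and adjoin this factor (and nothing else
    of the extension) to the current system. When each pair recurs infinitely
    often, no extension of the inverse limit improves the distance of the
    indicator of a cylinder. This passes to bounded functions, because the
    residual condition is linear in [f] and the distance condition is closed
    under [L^1]-limits. The limit is generated by [X0] and the adjoined factors
    by construction.

    All systems are coded on the Cantor space, where joint laws of countably many
    factor maps, and projective limits of laws, are measures on one space. *)

Set Implicit Arguments.
Unset Strict Implicit.
Unset Printing Implicit Defensive.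

Import Order.TTheory GRing.Theory Num.Theory.
Import numFieldNormedType.Exports.

Local Open Scope classical_set_scope.
Local Open Scope ring_scope.

(** * The Cantor space as a universal standard Borel space *)

Lemma measurable_preimage d d' (T : measurableType d) (T' : measurableType d')
    (f : T -> T') (A : set T') :
  measurable_fun setT f -> measurable A -> measurable (f @^-1` A).
Proof. by move=> mf mA; rewrite -[X in measurable X]setTI; exact: mf. Qed.

Lemma push_probability d d' (T : measurableType d) (T' : measurableType d')
    (R : realType) (P : probability T R) (f : T -> T') :
  measurable_fun setT f ->
  {Q : probability T' R | forall A, Q A = P (f @^-1` A)}.
Proof.
move=> mf; pose fM := isMeasurableFun.Build _ _ _ _ _ mf.
pose F : {mfun T >-> T'} := HB.pack f fM.
by exists (distribution P F).
Qed.

Section cube.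
Context {J : Type}.

(** Prescribing only ones keeps these cylinders closed under intersection, by concatenation of
    lists, and they still generate the product sigma-algebra. *)
Definition ones (s : seq J) : set (J -> bool) := [set x : J -> bool | all x s].

Definition cube := g_sigma_algebraType (range ones).

Lemma ones_measurable s : @measurable _ cube (ones s).
Proof. by apply: sub_gen_smallest; exists s. Qed.

Lemma setI_closed_ones : setI_closed (range ones).
Proof.
move=> _ _ [s _ <-] [t _ <-]; exists (s ++ t) => //.
by apply/seteqP; split=> x; rewrite /ones /= all_cat => /andP.
Qed.

Lemma coord_measurable j : measurable [set x : cube | x j].
Proof.
rewrite (_ : [set x | _] = ones [:: j]); first exact: ones_measurable.
by apply/seteqP; split=> x; rewrite /ones /= andbT.
Qed.

Lemma measurable_fun_cube d (T : measurableType d) (f : T -> cube) :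
  (forall j, measurable [set t | f t j]) -> measurable_fun setT f.
Proof.
move=> mf; apply: (@measurability _ _ T cube setT f (range ones)) => //.
move=> _ [_ [s _ <-] <-]; rewrite setTI.
elim: s => [|j s IHs].
  by rewrite (_ : _ @^-1` _ = setT)//; apply/seteqP; split.
rewrite (_ : _ @^-1` _ = [set t | f t j] `&` f @^-1` ones s).
  by apply: measurableI => //; exact: mf.
by apply/seteqP; split=> x; rewrite /ones /= => /andP.
Qed.

Lemma measurable_fun_coord d (T : measurableType d) (f : T -> cube) j :
  measurable_fun setT f -> measurable [set t | f t j].
Proof. by move=> mf; exact: (measurable_preimage mf (coord_measurable j)). Qed.

Lemma cube_measure_unique (R : realType) (P Q : probability cube R) :
  (forall s, P (ones s) = Q (ones s)) -> forall A, measurable A -> P A = Q A.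
Proof.
move=> PQ A mA.
apply: (@measure_unique _ R cube (range ones) (fun=> setT)) => //.
- exact: setI_closed_ones.
- by move=> _; exists [::] => //; apply/seteqP; split.
- by rewrite bigcup_const//; exists 0%N.
- by move=> _ [s _ <-]; exact: PQ.
- by move=> _; rewrite /= probability_setT ltry.
Qed.

End cube.
Arguments cube : clear implicits.

(** * Standard Borel spaces as measurable retracts of the line and of the Cantor space *)

Section retract.

(** Retractions compose without any bookkeeping of Borel images, and a coded point is decoded
    exactly, not just almost everywhere. *)
Definition retract d d' (T : measurableType d) (S : measurableType d') :=
  exists (e : T -> S) (r : S -> T),
    [/\ measurable_fun setT e, measurable_fun setT r & cancel e r].

Lemma retract_trans d d' d'' (T : measurableType d) (S : measurableType d')
    (U : measurableType d'') : retract T S -> retract S U -> retract T U.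
Proof.
move=> [e [r [me mr er]]] [e' [r' [me' mr' er']]].
exists (e' \o e), (r \o r'); split.
- exact: measurableT_comp.
- exact: measurableT_comp.
- by move=> x /=; rewrite er' er.
Qed.

Lemma retract_cube (J : countType) : retract (cube J) (cube nat).
Proof.
exists (fun x i => if unpickle i is Some j then x j else false).
exists (fun y j => y (pickle j)); split.
- apply: measurable_fun_cube => i; case: (unpickle i) => [j|].
    exact: coord_measurable.
  by rewrite (_ : [set _ | _] = set0)//; apply/seteqP; split.
- by apply: measurable_fun_cube => j; exact: coord_measurable.
- by move=> x; apply/funext => j; rewrite pickleK.
Qed.

Context {R : realType}.

(** A real is coded by its Dedekind cut and recovered as the supremum of the rationals in the
    cut. *)
Lemma retract_real_cube : retract (measurableTypeR R) (cube nat).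
Proof.
apply: (@retract_trans _ _ _ _ (cube rat)); last exact: retract_cube.
pose F (i : nat) (b : cube rat) : \bar R :=
  if unpickle i is Some q then if b q then (ratr q)%:E else -oo%E else -oo%E.
exists (fun x q => ratr q < x), (fun b => fine (esups (F ^~ b) 0%N)); split.
- apply: measurable_fun_cube => q.
  rewrite (_ : [set _ | _] = `]ratr q, +oo[%classic)//.
  by apply/seteqP; split=> x /=; rewrite in_itv/= andbT.
- apply: measurableT_comp; first exact: fine_measurable.
  apply: measurable_fun_esups => i; rewrite /F; case: (unpickle i) => [q|//].
  apply: measurable_fun_ifT => //; apply: (measurable_fun_bool true).
  by rewrite setTI; exact: coord_measurable.
- move=> x; rewrite (_ : esups _ _ = x%:E)//; apply/eqP.
  rewrite eq_le; apply/andP; split.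
    apply: ge_ereal_sup => _ [i _ <-]; rewrite /F.
    case: (unpickle i) => [q|]; rewrite ?leNye//.
    by case: ifPn => [/ltW|]; rewrite ?leNye ?lee_fin.
  apply/lee_subgt0Pr => e e0.
  have : x - e < x by rewrite ltrBlDr ltrDl.
  move=> /rat_in_itvoo[q]; rewrite in_itv/= => /andP[xq qx].
  apply: (@le_trans _ _ (ratr q)%:E); first by rewrite -EFinB lee_fin ltW.
  apply: ereal_sup_ubound; exists (pickle q) => //.
  by rewrite /F pickleK qx.
Qed.

(** Greedy expansion in base 3 with digits 0 and 1; the remainder is rescaled each time, so that
    every digit is read by comparison with 1. *)
Local Fixpoint ternary_rest (y : R) (k : nat) : R :=
  if k is k'.+1 then 3 * (ternary_rest y k' - (1 <= ternary_rest y k')%R%:R)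
  else y.

Let digit (b : nat -> bool) k : \bar R := ((b k)%:R * 3^-1 ^+ k)%:E.

Let digit_ge0 b k : (0 <= digit b k)%E.
Proof. by rewrite lee_fin mulr_ge0// exprn_ge0// invr_ge0. Qed.

Let T (b : nat -> bool) : \bar R := (\sum_(0 <= k <oo) digit b k)%E.

Let TS b : T b = ((b 0%N)%:R%:E + (3^-1)%:E * T (fun k => b k.+1))%E.
Proof.
rewrite /T nneseries_recl//; congr (_ + _)%E; first by rewrite /digit expr0 mulr1.
rewrite -nneseriesZl//.
rewrite -(@nneseries_addn _ (digit b) 1%N); last by move=> *; exact: digit_ge0.
apply: eq_eseriesr => k _.
by rewrite /digit -EFinM addn1 exprS mulrCA.
Qed.

Let T_bound b : (0 <= T b <= (3 / 2)%:E)%E.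
Proof.
apply/andP; split; first by apply: nneseries_ge0 => *; exact: digit_ge0.
have -> : (3 / 2)%:E = (\sum_(0 <= k <oo) (3^-1 ^+ k)%:E)%E :> \bar R.
  apply/esym/cvg_lim => //.
  have -> : (fun n => \sum_(0 <= k < n) (3^-1 ^+ k : R)%:E)%E =
     EFin \o series (geometric 1 (3^-1 : R)).
    apply/funext => n /=; rewrite sumEFin; congr EFin.
    by apply: eq_bigr => k _; rewrite /geometric /= mul1r.
  apply/cvg_EFin; first exact: nearW.
  have -> : 3 / 2 = 1 * (1 - 3^-1)^-1 :> R by field.
  apply: cvg_geometric_series; rewrite ger0_norm; lra.
apply: lee_nneseries => [*|k *]; first exact: digit_ge0.
by rewrite lee_fin; case: (b k); rewrite ?mul1r// mul0r exprn_ge0// invr_ge0.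
Qed.

Let t b := fine (T b).

Let TE b : T b = (t b)%:E.
Proof.
have /andP[T0 T1] := T_bound b; rewrite /t fineK// ge0_fin_numE//.
by rewrite (le_lt_trans T1)// ltry.
Qed.

Let tS b : t b = (b 0%N)%:R + 3^-1 * t (fun k => b k.+1).
Proof. by have := TS b; rewrite !TE -EFinM -EFinD => -[]. Qed.

(** The digits after the first contribute at most [3^-1 * (3 / 2) = 1 / 2], so the sum reaches 1
    exactly when the first digit is 1. *)
Let t_digit b : (1 <= t b) = b 0%N.
Proof.
have := T_bound (fun k => b k.+1); rewrite TE !lee_fin => /andP[h0 h1].
rewrite tS; case: (b 0%N) => /=; first by apply/idP; lra.
by apply/negbTE; rewrite -ltNge; lra.
Qed.

Let ternary_restE b k : ternary_rest (t b) k = t (fun i => b (k + i)%N).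
Proof.
elim: k => [|k IHk]/=; first by [].
rewrite IHk t_digit addn0 [in X in X - _]tS addn0.
rewrite (_ : (fun i => b (k.+1 + i)%N) = fun i => b (k + i.+1)%N); last first.
  by apply/funext => i; rewrite addSnnS.
by lra.
Qed.

(* Base 3 rather than 2: the greedy digits then recover the sequence. *)
Lemma retract_cube_real : retract (cube nat) (measurableTypeR R).
Proof.
exists t, (fun y k => 1 <= ternary_rest y k); split.
- apply: measurableT_comp; first exact: fine_measurable.
  apply: ge0_emeasurable_sum => [k x _ _|k _]; first exact: digit_ge0.
  apply/measurable_EFinP; apply: measurable_funM => //.
  rewrite (_ : (fun _ => _) = fun x : cube nat => if x k then 1 else 0).
    apply: measurable_fun_ifT => //; apply: (measurable_fun_bool true).
    by rewrite setTI; exact: coord_measurable.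
  by apply/funext => x; case: (x k).
- have mT k : measurable_fun setT (fun y : measurableTypeR R => ternary_rest y k).
    elim: k => [|k IHk]/=; first exact: measurable_id.
    apply: measurable_funM => //; apply: measurable_funB => //.
    rewrite (_ : (fun _ => _) =
        fun y : R => if 1 <= ternary_rest y k then 1 else 0).
      by apply: measurable_fun_ifT => //; exact: measurable_fun_ler.
    by apply/funext => y; case: (1 <= _).
  apply: measurable_fun_cube => k.
  rewrite (_ : [set _ | _] =
    (fun y : measurableTypeR R => ternary_rest y k) @^-1` `[1, +oo[).
    exact: (measurable_preimage (mT k) (measurable_itv _)).
  by apply/seteqP; split=> y /=; rewrite in_itv/= andbT.
- by move=> b; apply/funext => k; rewrite ternary_restE t_digit addn0.
Qed.

Lemma standard_borel_retract d (S : measurableType d) :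
  standard_borel R S -> retract S (measurableTypeR R).
Proof.
move=> [A [f [g [mA [mf [mg [Af [gf fg]]]]]]]].
(* Nothing is known about [g] outside the Borel set [A], so a default point is used there. *)
exists f, (fun y => if y \in A then g y else point); split => //.
- apply: measurable_fun_if => //.
  + by apply: (measurable_fun_bool true); rewrite setTI preimage_mem_true.
  + by rewrite setTI preimage_mem_true.
- by move=> x; rewrite mem_set.
Qed.

(** The Borel set is the range of [e], which is the set of fixed points of [e \o r] and hence the
    zero set of a measurable function. *)
Lemma retract_standard_borel d (S : measurableType d) :
  retract S (measurableTypeR R) -> standard_borel R S.
Proof.
move=> [e [r [me mr er]]].
exists [set y | e (r y) = y], e, r; split; last first.
  split => //; split; first exact: measurable_funTS.
  by split => [x /=|]; rewrite ?er.
rewrite (_ : [set _ | _] = (fun y => e (r y) - y) @^-1` [set 0]).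
  apply: (@measurable_preimage _ _ (measurableTypeR R) (measurableTypeR R)) => //.
  apply: measurable_funB => //; exact: measurableT_comp.
by apply/seteqP; split=> y /= => [->|/eqP]; rewrite ?subrr// subr_eq0 => /eqP.
Qed.

Lemma cube_standard_borel (J : countType) : standard_borel R (cube J).
Proof.
apply: retract_standard_borel.
exact: retract_trans (retract_cube J) retract_cube_real.
Qed.

Lemma standard_borel_retract_cube d (S : measurableType d) :
  standard_borel R S -> retract S (cube nat).
Proof.
move=> /standard_borel_retract sS; apply: retract_trans sS _.
exact: retract_real_cube.
Qed.

End retract.

(** * Projective limits *)

Section kolmogorov.
Context {R : realType}.

(* Words are read backwards: the last letter comes first. *)
Fixpoint prefix_word (x : nat -> bool) (n : nat) : seq bool :=
  if n is n'.+1 then x n' :: prefix_word x n' else [::].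

Lemma size_prefix_word x n : size (prefix_word x n) = n.
Proof. by elim: n => //= n ->. Qed.

(** Only the first [n] letters are assumed measurable, since [bits_at_measurable] uses this inside a
    strong induction on the letter. *)
Lemma prefix_word_measurable d (T : measurableType d) (f : T -> nat -> bool)
    n w :
  (forall i, (i < n)%N -> measurable [set t | f t i]) ->
  measurable [set t | prefix_word (f t) n = w].
Proof.
elim: n w => [|n IHn] w mf /=.
  case: w => [|b w].
    by rewrite (_ : [set _ | _] = setT)//; apply/seteqP; split.
  by rewrite (_ : [set _ | _] = set0)//; apply/seteqP; split.
case: w => [|b w].
  by rewrite (_ : [set _ | _] = set0)//; apply/seteqP; split.
rewrite (_ : [set _ | _] =
    (if b then [set t | f t n] else ~` [set t | f t n]) `&`
    [set t | prefix_word (f t) n = w]); last first.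
  apply/seteqP; split=> t /=.
    by case=> <- <-; split => //; case: ifPn => // /negP.
  by case: b => /= -[ft <-]; [rewrite ft|rewrite (negbTE (introN idP ft))].
apply: measurableI; last by apply: IHn => i ni; apply: mf; exact: ltnW.
by case: b; [exact: mf|apply: measurableC; exact: mf].
Qed.

Section premeasure.
Variable m : seq bool -> R.
Hypotheses (m_ge0 : forall w, 0 <= m w) (m_nil : m [::] = 1).
Hypothesis m_split : forall w, m w = m (false :: w) + m (true :: w).

(* The unit interval is cut into subintervals [word_left w, word_left w + m w),
   nested like the words; reading off the word of a point pushes Lebesgue
   measure to a measure giving the cylinder of [w] mass [m w]. *)
Fixpoint word_left (w : seq bool) : R :=
  if w is b :: w' then word_left w' + (if b then m (false :: w') else 0) else 0.

Fixpoint word_at (u : R) (n : nat) : seq bool :=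
  if n is n'.+1 then
    (word_left (word_at u n') + m (false :: word_at u n') <= u) :: word_at u n'
  else [::].

Definition bits_at (u : R) (n : nat) : bool :=
  word_left (word_at u n) + m (false :: word_at u n) <= u.

Lemma prefix_bits_at u n : prefix_word (bits_at u) n = word_at u n.
Proof. by elim: n => //= n ->. Qed.

(** Each new letter tells in which of the two half-open parts of the current interval [u] lies; by
    [m_split] the parts fill it. A part of length zero contains no point, in accordance with its
    word never being read. *)
Lemma word_atE w u : 0 <= u < 1 ->
  word_at u (size w) = w <-> word_left w <= u < word_left w + m w.
Proof.
move=> u01; elim: w => [|b w IHw] /=; first by rewrite m_nil add0r; split.
have mf := m_ge0 (false :: w); have mt := m_ge0 (true :: w).
have ms := m_split w; split.
- case=> + e; rewrite e; have /IHw /andP[h1 h2] := e.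
  by case: b => [h|/negbT]; rewrite -?ltNge ?addr0 => *; apply/andP; split; lra.
- move=> h; have e : word_at u (size w) = w.
    by apply/IHw; move: h; case: b => /andP[h1 h2]; apply/andP; split; lra.
  rewrite e; congr (_ :: _); move: h; case: b => /andP[h1 h2].
    by apply/idP; lra.
  by apply/negbTE; rewrite -ltNge; lra.
Qed.

Lemma bits_at_measurable i : measurable [set u : measurableTypeR R | bits_at u i].
Proof.
elim/ltn_ind: i => i IHi.
rewrite (_ : [set _ | _] = \bigcup_(w : seq bool)
  ([set u : measurableTypeR R | prefix_word (bits_at u) i = w] `&`
   `[word_left w + m (false :: w), +oo[%classic)); last first.
  apply/seteqP; split=> u /=.
    move=> ui; exists (word_at u i) => //; split; first exact: prefix_bits_at.
    by rewrite /= in_itv/= andbT.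
  by move=> [w _ [/=]]; rewrite prefix_bits_at => <-; rewrite in_itv/= andbT.
apply: countable_bigcupT_measurable; first exact: countableP.
move=> w; apply: measurableI; last exact: measurable_itv.
exact: prefix_word_measurable.
Qed.

Lemma probability_of_premeasure : exists P : probability (cube nat) R,
  forall w, P [set x | prefix_word x (size w) = w] = (m w)%:E.
Proof.
have mI : measurable (`[0, 1[%classic : set (measurableTypeR R)).
  exact: measurable_itv.
pose mu := mrestr (@lebesgue_measure R) mI.
have mu1 : mu setT = 1%E.
  by rewrite /mu /mrestr setTI lebesgue_measure_itv/= lte_fin ltr01 oppr0 adde0.
pose muM := Measure_isProbability.Build _ _ _ mu mu1.
pose U : probability (measurableTypeR R) R := HB.pack mu muM.
have mb : @measurable_fun _ _ (measurableTypeR R) (cube nat) setT bits_at.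
  by apply: measurable_fun_cube => i; exact: bits_at_measurable.
have [P PE] := push_probability U mb.
exists P => w; rewrite PE /= /mu /mrestr.
rewrite (_ : _ `&` _ = `[word_left w, word_left w + m w[%classic).
  rewrite lebesgue_measure_itv/= lte_fin ltrDl.
  case: ifPn => [_|]; first by rewrite -EFinD addrAC subrr add0r.
  by rewrite -leNgt => mw; congr EFin; apply/eqP; rewrite eq_le m_ge0 mw.
(* Lebesgue measure was restricted to the unit interval, which must not cut off any part of the
   interval of [w]. *)
have word_in : 0 <= word_left w /\ word_left w + m w <= 1.
  elim: w => [|b w [h1 h2]]/=; first by rewrite m_nil add0r.
  have := m_split w; have := m_ge0 (false :: w); have := m_ge0 (true :: w).
  by case: b; split; lra.
apply/seteqP; split=> u; rewrite /= !in_itv/= prefix_bits_at.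
  by case=> uw u01; apply/word_atE.
move=> h; have u01 : 0 <= u < 1.
  by case: word_in => ? ?; case/andP: h => ? ?; apply/andP; split; lra.
by split => //; apply/word_atE.
Qed.

End premeasure.

Lemma eq_prefix_word x y n :
  prefix_word x n = prefix_word y n <-> (forall i, (i < n)%N -> x i = y i).
Proof.
elim: n => [|n IHn] /=; first by split.
split=> [[xy /IHn xyn] i|xy].
  by rewrite ltnS leq_eqVlt => /predU1P[->//|]; exact: xyn.
by congr (_ :: _); [exact: xy|apply/IHn => i ni; apply: xy; exact: ltnW].
Qed.

(** Such an event is a disjoint union of cylinders of words of length [n]. The pieces are indexed by
    codes of words to use countable additivity; words of other lengths give empty pieces. *)
Lemma prefix_event_unique (P Q : probability (cube nat) R) n (E : set (cube nat)) :
  (forall w, size w = n -> P [set x | prefix_word x (size w) = w] =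
                           Q [set x | prefix_word x (size w) = w]) ->
  measurable E ->
  (forall x y, prefix_word x n = prefix_word y n -> E x -> E y) ->
  P E = Q E.
Proof.
move=> PQ mE En.
pose F (i : nat) : set (cube nat) :=
  if pickle_inv i is Some w then E `&` [set x | prefix_word x n = w] else set0.
have mF i : measurable (F i).
  rewrite /F; case: (pickle_inv i) => // w; apply: measurableI => //.
  by apply: prefix_word_measurable => *; exact: coord_measurable.
have tF : trivIset setT F.
  apply/trivIsetP => i j _ _ /eqP ij; apply/seteqP; split=> // x [].
  rewrite /F; have := @pickle_invK (seq bool) i.
  have := @pickle_invK (seq bool) j.
  case: (pickle_inv i) => [w|//]; case: (pickle_inv j) => [v|//].
  by rewrite /= => vj wi [_ /= xw] [_ /= xv]; apply: ij; rewrite -vj -wi -xw -xv.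
have EF : E = \bigcup_i F i.
  apply/seteqP; split=> [x Ex|x [i _]].
    by exists (pickle (prefix_word x n)) => //; rewrite /F pickleK_inv.
  by rewrite /F; case: (pickle_inv i) => // w [].
rewrite EF !measure_semi_bigcup// -?EF//.
apply: eq_eseriesr => i _; rewrite /F.
case: (pickle_inv i) => [w|]; last by rewrite !measure0.
have [[x [Ex xw]]|none] :=
  pselect (exists x, (E `&` [set x | prefix_word x n = w]) x).
  have wn : size w = n by rewrite -xw size_prefix_word.
  rewrite (_ : E `&` _ = [set x | prefix_word x (size w) = w]); first exact: PQ.
  rewrite wn; apply/seteqP; split=> y /= => [[]//|yw]; split=> //.
  by apply: En Ex; rewrite yw xw.
rewrite (_ : E `&` _ = set0) ?measure0//.
by apply/seteqP; split=> // x Ex; apply: none; exists x.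
Qed.

(** A point is read as a sequence of blocks, the first index being the number of the block. *)
Definition trunc (n : nat) (x : cube (nat * nat)) : cube (nat * nat) :=
  fun p => x (minn p.1 n, p.2).

Lemma trunc_measurable n : measurable_fun setT (trunc n).
Proof. by apply: measurable_fun_cube => p; exact: coord_measurable. Qed.

Lemma trunc_trunc n m x : (n <= m)%N -> trunc n (trunc m x) = trunc n x.
Proof.
move=> nm; apply/funext => -[k j] /=; rewrite /trunc /=.
by rewrite -minnA (minn_idPl nm).
Qed.

(** After enumerating the coordinates, the mass of a word is taken from any stage late enough to
    contain all blocks that the word meets. Consistency makes the choice of stage immaterial, so
    these masses are additive in the last letter and come from a measure. *)
Lemma projective_limit (P : nat -> probability (cube (nat * nat)) R) :
  (forall n A, measurable A -> P n A = P n.+1 (trunc n @^-1` A)) ->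
  exists Q : probability (cube (nat * nat)) R,
    forall n A, measurable A -> P n A = Q (trunc n @^-1` A).
Proof.
move=> PS.
have mtr n A : measurable A -> measurable (trunc n @^-1` A).
  by move=> mA; apply: measurable_preimage => //; exact: trunc_measurable.
have Ple n m A : (n <= m)%N -> measurable A -> P n A = P m (trunc n @^-1` A).
  move=> nm mA; rewrite -(subnKC nm); elim: (m - n)%N => [|k IHk].
    (* [P n] does not see past block [n]: both sides agree when lifted to stage [n.+1], as [trunc n]
       is idempotent. *)
    rewrite addn0 (PS n A)// (PS n (trunc n @^-1` A)); last exact: mtr.
    by congr (P _ _); apply/seteqP; split=> x /=; rewrite trunc_trunc.
  rewrite IHk addnS PS; last exact: mtr.
  by congr (P _ _); apply/seteqP; split=> x /=; rewrite trunc_trunc ?leq_addr.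
(* A number that codes no pair repeats the coordinate [(0, 0)]; [unio] below reads only the codes of
   pairs. *)
pose dec i : nat * nat := odflt (0, 0)%N (unpickle i).
(* A sum instead of a maximum: it bounds the blocks met by the first [k] letters and is clearly
   monotone. *)
pose N k := (\sum_(i < k) (dec i).1)%N.
have leN i k : (i < k)%N -> ((dec i).1 <= N k)%N.
  by move=> ik; rewrite /N (bigD1 (Ordinal ik))//= leq_addr.
pose iota (x : cube (nat * nat)) : cube nat := fun i => x (dec i).
have miota : measurable_fun setT iota.
  by apply: measurable_fun_cube => i; exact: coord_measurable.
pose cyl w : set (cube (nat * nat)) := [set x | prefix_word (iota x) (size w) = w].
have mcyl w : measurable (cyl w).
  by apply: prefix_word_measurable => *; exact: coord_measurable.
have Pcyl n w : (N (size w) <= n)%N -> P n (cyl w) = P (N (size w)) (cyl w).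
  move=> wn; rewrite (Ple _ n (cyl w) wn)//; congr (P n _).
  have e x : prefix_word (iota (trunc (N (size w)) x)) (size w) =
             prefix_word (iota x) (size w).
    apply/eq_prefix_word => i wi; rewrite /iota /trunc (minn_idPl (leN _ _ wi)).
    by case: (dec i).
  by apply/seteqP; split=> x; rewrite /cyl /= e.
pose m w := fine (P (N (size w)) (cyl w)).
have mE n w : (N (size w) <= n)%N -> (m w)%:E = P n (cyl w).
  by move=> wn; rewrite (Pcyl n)// /m fineK// fin_num_measure.
have NS k : (N k <= N k.+1)%N by rewrite /N big_ord_recr/= leq_addr.
have [||w|Q' Q'E] := @probability_of_premeasure m.
- by move=> w; rewrite /m fine_ge0.
- rewrite /m (_ : cyl _ = setT) ?probability_setT//.
  by apply/seteqP; split.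
- apply/EFin_inj; rewrite EFinD.
  rewrite !(mE (N (size w).+1))//=.
  rewrite -measureU//.
    congr (P _ _); apply/seteqP; split=> x; rewrite /cyl/=.
      by move=> ->; case: (iota x (size w)); [right|left].
    by case=> -[_].
  by apply/seteqP; split=> // x []; rewrite /cyl/= => -[-> _] [].
pose unio (y : cube nat) : cube (nat * nat) := fun p => y (pickle p).
have munio : measurable_fun setT unio.
  by apply: measurable_fun_cube => p; exact: coord_measurable.
have [Q QE] := push_probability Q' munio; exists Q => n A mA.
have [Qn QnE] := push_probability Q (trunc_measurable n).
rewrite -QnE; apply: cube_measure_unique A mA => s; rewrite QnE QE.
pose cl (p : nat * nat) := pickle (minn p.1 n, p.2).
pose K := (\sum_(p <- s) (cl p).+1)%N.
have leK p : p \in s -> (cl p < K)%N.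
  by move=> ps; rewrite /K (big_rem p)//= leq_addr.
(* This stage is late enough to be compared both with [P n] and, on words of length [K], with [Q'].
   The letters below [K] include all those read by the truncated cylinder. *)
pose M := maxn n (N K).
have [I IE] := push_probability (P M) miota.
rewrite (@prefix_event_unique Q' I K).
- rewrite IE (Ple n M (ones s)) ?leq_maxl//; last exact: ones_measurable.
  congr (P M _); apply/seteqP; split=> x; rewrite /ones /= /iota /unio /trunc;
    by apply: sub_all => p /=; rewrite /dec pickleK.
- move=> w wK; rewrite IE Q'E (mE M) ?wK ?leq_maxr//.
  by congr (P M _); rewrite /cyl wK.
- apply: (measurable_preimage munio); apply: mtr; exact: ones_measurable.
- move=> x y /eq_prefix_word xy; rewrite /ones /unio /trunc /=.
  by move=> /allP h; apply/allP => p ps; rewrite -[y _]xy ?leK//; exact: h.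
Qed.

End kolmogorov.

(** * Countable joinings *)

Section systems.
Context {R : realType} {G : semigroup}.
Local Notation system := (system R G).

Lemma factor_map_id (X : system) : factor_map (fun x : sys_T X => x).
Proof. by split; [exact: measurable_id|split]. Qed.

Lemma factor_map_comp (X Y Z : system) (f : sys_T X -> sys_T Y)
    (h : sys_T Y -> sys_T Z) :
  factor_map f -> factor_map h -> factor_map (h \o f).
Proof.
move=> [mf [pf ef]] [mh [ph eh]]; split; first exact: measurableT_comp.
split=> [B mB|g x /=]; last by rewrite eh ef.
by rewrite comp_preimage pf ?ph//; exact: measurable_preimage.
Qed.

Lemma symdiff_measurable d (T : measurableType d) (A B : set T) :
  measurable A -> measurable B -> measurable (symdiff A B).
Proof. by move=> mA mB; apply: measurableU; exact: measurableD. Qed.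

Lemma preimage_symdiff T T' (f : T -> T') (A B : set T') :
  f @^-1` symdiff A B = symdiff (f @^-1` A) (f @^-1` B).
Proof. by []. Qed.

Lemma symdiffv T (A : set T) : symdiff A A = set0.
Proof. by rewrite /symdiff setDv setU0. Qed.

Lemma max_factor_pullback C (X Y : system) (f : sys_T X -> sys_T Y) A :
  factor_map f -> max_factor C Y A -> max_factor C X (f @^-1` A).
Proof.
move=> hf [mA [Z [zeta [CZ [hz [B [mB AB]]]]]]]; have [mf [pf _]] := hf.
split; first exact: measurable_preimage.
exists Z, (zeta \o f); split => //; split; first exact: factor_map_comp.
exists B; split=> //; rewrite comp_preimage -preimage_symdiff pf//.
by apply: symdiff_measurable => //; apply: measurable_preimage => //; case: hz.
Qed.

Record action (J : countType) := Action {
  act_fun :> G -> cube J -> cube J;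
  act_measurable : forall g, measurable_fun setT (act_fun g);
  act_comp : forall g h x, act_fun (sg_op G g h) x = act_fun g (act_fun h x) }.

Definition invariant_under (J : countType) (a : action J)
    (P : probability (cube J) R) :=
  forall g (A : set (cube J)), measurable A -> P (a g @^-1` A) = P A.

Definition cube_system (J : countType) (a : action J)
    (P : probability (cube J) R) (Pa : invariant_under a P) : system :=
  System R G _ (cube J) P a (cube_standard_borel J) (act_measurable a) Pa
    (act_comp a).

Lemma push_invariant (X : system) (J : countType) (a : action J)
    (f : sys_T X -> cube J) (P : probability (cube J) R) :
  measurable_fun setT f ->
  (forall g x, f (sys_act X g x) = a g (f x)) ->
  (forall A, P A = sys_mu X (f @^-1` A)) ->
  invariant_under a P.
Proof.
move=> mf ef PE g A mA; rewrite !PE -(sys_act_pres _ _ X g (f @^-1` A)); last first.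
  exact: measurable_preimage.
by congr (sys_mu X _); apply/seteqP; split=> x /=; rewrite ef.
Qed.

Lemma push_system (X : system) (J : countType) (a : action J)
    (f : sys_T X -> cube J) :
  measurable_fun setT f ->
  (forall g x, f (sys_act X g x) = a g (f x)) ->
  {P : probability (cube J) R & {Pa : invariant_under a P |
    factor_map (Y := cube_system Pa) f &
    forall A, P A = sys_mu X (f @^-1` A)}}.
Proof.
move=> mf ef; have [P PE] := push_probability (sys_mu X) mf.
exists P; exists (push_invariant mf ef PE) => //.
by split=> //; split=> [B mB|g x]; rewrite /= ?PE// ef.
Qed.

(* [encode] need not be onto, so the decoded factors generate a system of coded
   blocks only modulo null sets. *)
Record coding (Y : system) := Coding {
  code_act : action nat;
  encode : sys_T Y -> cube nat;
  decode : cube nat -> sys_T Y;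
  encode_measurable : measurable_fun setT encode;
  decode_measurable : measurable_fun setT decode;
  encodeK : cancel encode decode;
  encode_act : forall g y, encode (sys_act Y g y) = code_act g (encode y);
  decode_act : forall g x, decode (code_act g x) = sys_act Y g (decode x) }.

Lemma coding_of (Y : system) : coding Y.
Proof.
have /cid[e /cid[r [me mr er]]] := standard_borel_retract_cube (sys_std _ _ Y).
have ma g : measurable_fun setT (fun x => e (sys_act Y g (r x))).
  apply: measurableT_comp => //; apply: measurableT_comp => //.
  exact: sys_act_meas.
have ac g h x : e (sys_act Y (sg_op G g h) (r x)) =
    e (sys_act Y g (r (e (sys_act Y h (r x))))) by rewrite er sys_act_comp.
by exists (@Action nat _ ma ac) e r => //= g y; rewrite er.
Qed.

Definition block (k : nat) (x : cube (nat * nat)) : cube nat :=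
  fun j => x (k, j).

Lemma block_measurable k : measurable_fun setT (block k).
Proof. by apply: measurable_fun_cube => j; exact: coord_measurable. Qed.

Definition glue T (z : nat -> T -> cube nat) (t : T) : cube (nat * nat) :=
  fun p => z p.1 t p.2.

Lemma glue_measurable d (T : measurableType d) (z : nat -> T -> cube nat) :
  (forall k, measurable_fun setT (z k)) -> measurable_fun setT (glue z).
Proof.
move=> mz; apply: measurable_fun_cube => p.
exact: (measurable_fun_coord _ (mz p.1)).
Qed.

Lemma product_action_measurable (a : nat -> action nat) g :
  measurable_fun setT (glue (fun k => a k g \o block k)).
Proof.
apply: glue_measurable => k; apply: measurableT_comp.
  exact: act_measurable.
exact: block_measurable.
Qed.

Lemma product_action_comp (a : nat -> action nat) g h x :
  glue (fun k => a k (sg_op G g h) \o block k) x =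
  glue (fun k => a k g \o block k) (glue (fun k => a k h \o block k) x).
Proof. by apply/funext => p; rewrite /glue /= act_comp. Qed.

Definition product_action (a : nat -> action nat) : action (nat * nat)%type :=
  Action (product_action_measurable a) (product_action_comp a).

Lemma glue_equivariant (X : system) (a : nat -> action nat)
    (z : nat -> sys_T X -> cube nat) :
  (forall k g x, z k (sys_act X g x) = a k g (z k x)) ->
  forall g x, glue z (sys_act X g x) = product_action a g (glue z x).
Proof. by move=> ez g x; apply/funext => p; rewrite /glue /= ez. Qed.

Lemma trunc_equivariant (a b : nat -> action nat) n :
  (forall k, a k = b (minn k n)) ->
  forall g x, product_action a g (trunc n x) = trunc n (product_action b g x).
Proof. by move=> ab g x; apply/funext => p; rewrite /= /glue /= ab. Qed.

Lemma generates_measurable_fun (X : system) (F : set (set (sys_T X)))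
    (J : Type) (f : sys_T X -> cube J) :
  (forall j, <<s F >> [set x | f x j]) ->
  forall A, measurable A -> <<s F >> (f @^-1` A).
Proof.
move=> Ff A mA.
have mf : @measurable_fun _ _ (g_sigma_algebraType F) (cube J) setT f.
  exact: measurable_fun_cube.
exact: (measurable_preimage mf mA).
Qed.

(** The class is closed under finite joinings and inverse limits only, so the joint law of all the
    factors is presented as the inverse limit of the joint laws of the first [n.+1]. Since decoding
    inverts encoding, each [zeta n] is recovered at every point. *)
Lemma countable_join C (X : system) (Y : nat -> system)
    (zeta : forall n, sys_T X -> sys_T (Y n)) :
  idempotent_class C -> (forall n, C (Y n)) -> (forall n, factor_map (zeta n)) ->
  exists (Z : system) (xi : sys_T X -> sys_T Z)
         (r : forall n, sys_T Z -> sys_T (Y n)),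
    [/\ C Z, factor_map xi, forall n, measurable_fun setT (r n)
      & forall n x, r n (xi x) = zeta n x].
Proof.
move=> [_ [_ [Cjoin Clim]]] CY fz.
pose c n := coding_of (Y n).
pose a k := code_act (c k).
pose z k x := encode (c k) (zeta k x).
have mz k : measurable_fun setT (z k).
  by apply: measurableT_comp; [exact: encode_measurable|case: (fz k)].
have ez k g x : z k (sys_act X g x) = a k g (z k x).
  by rewrite /z -(proj2 (proj2 (fz k))) encode_act.
have [P [Pa fP PE]] := push_system (glue_measurable mz) (glue_equivariant ez).
(* The joining of the factors 0 to [n], padded with copies of the last, is the image of the full
   joint code under [trunc n]. *)
pose an n k := a (minn k n).
pose zn n k := z (minn k n).
have mzn n k : measurable_fun setT (zn n k) by exact: mz.
have ezn n k g x : zn n k (sys_act X g x) = an n k g (zn n k x) by exact: ez.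
pose pn n := push_system (glue_measurable (mzn n)) (glue_equivariant (ezn n)).
pose Zn n : system := cube_system (s2val (projT2 (pn n))).
have PnE n A : sys_mu (Zn n) A = sys_mu X (glue (zn n) @^-1` A).
  by rewrite /Zn; case: (pn n) => /= Q [Qa _ QE].
have CZn n : C (Zn n).
  pose p (i : 'I_n.+1) (x : sys_T (Zn n)) := decode (c i) (block i x).
  have min_i (i : 'I_n.+1) : minn i n = i by apply/minn_idPl; rewrite -ltnS.
  apply: (Cjoin _ _ (Zn n) p) => //; split.
    move=> i; split.
      apply: (measurableT_comp (decode_measurable (c i))).
      exact: block_measurable.
    split=> [B mB|g x].
      rewrite PnE -(proj1 (proj2 (fz i))) //; congr (sys_mu X _).
      apply/seteqP; split=> x; rewrite /p /= /block /glue /zn /= min_i;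
      by rewrite /z encodeK.
    by rewrite /p -decode_act /= /block /glue /= /an min_i.
  (* Re-encoding all blocks is measurable for the decoded factors and fixes every point in the image
     of [X]. So a set and its preimage under [rho] differ by a set whose preimage in [X] is
     empty. *)
  pose er k x := encode (c k) (decode (c k) x).
  pose rho (x : sys_T (Zn n)) : cube (nat * nat) :=
    fun q => er (minn q.1 n) (block (minn q.1 n) x) q.2.
  move=> A mA; exists (rho @^-1` A); split.
    apply: generates_measurable_fun mA => -[k j]; apply: sub_gen_smallest.
    have kn : (minn k n < n.+1)%N by rewrite ltnS geq_minr.
    exists (Ordinal kn) => //.
    exists [set y | encode (c (minn k n)) y j] => //.
    exact: (measurable_fun_coord _ (encode_measurable _)).
  have rhoE x : rho (glue (zn n) x) = glue (zn n) x.
    apply/funext => -[k j].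
    by rewrite /rho /er /= /block /glue /zn /= -minnA minnn /z encodeK.
  rewrite PnE (_ : _ @^-1` _ = set0) ?measure0//.
  by apply/seteqP; split=> // x /= [] [] /=; rewrite rhoE.
exists (cube_system Pa), (glue z), (fun n => decode (c n) \o block n); split => //.
- apply: (Clim Zn (fun n => trunc n) (cube_system Pa) (fun n => trunc n)) => //.
  split.
    move=> n; split; first exact: trunc_measurable.
    split=> [B mB|g x].
      rewrite !PnE; congr (sys_mu X _).
      have trE x : trunc n (glue (zn n.+1) x) = glue (zn n) x.
        apply/funext => -[k j]; rewrite /trunc /glue /= /zn.
        by rewrite -minnA (minn_idPl (leqnSn n)).
      by apply/seteqP; split=> x /=; rewrite trE.
    apply: trunc_equivariant => k; rewrite /an -minnA.
    by rewrite (minn_idPl (leqnSn n)).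
  split.
    move=> n; split; first exact: trunc_measurable.
    split=> [B mB|g x]; last exact: trunc_equivariant.
    by rewrite /= PE PnE.
  split=> [n x|A mA].
    by apply/funext => -[k j]; rewrite /trunc /= -minnA (minn_idPl (leqnSn n)).
  exists A; split; last by rewrite symdiffv measure0.
  apply: (@generates_measurable_fun (cube_system Pa) _ (nat * nat)%type
    (fun x => x) _ A mA) => -[k j].
  apply: sub_gen_smallest; exists k => //.
  exists [set x : cube (nat * nat) | x (k, j)]; first exact: coord_measurable.
  by apply/seteqP; split=> x /=; rewrite /trunc /= minnn.
- move=> n; apply: measurableT_comp; first exact: decode_measurable.
  exact: block_measurable.
- by move=> n x /=; rewrite -[RHS](encodeK (c n)).
Qed.

End systems.

(** * Expectations of bounded functions *)

Section expectation.
Context {R : realType} {G : semigroup}.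
Local Notation system := (system R G).

Definition Ex (X : system) (f : sys_T X -> R) : R :=
  Rintegral (sys_mu X) setT f.
Arguments Ex : clear implicits.
Local Notation bm := bounded_measurable.

Section bounded.
Variable X : system.
Implicit Types f h : sys_T X -> R.

Lemma bm_cst (c : R) : bm (X := X) (fun=> c).
Proof. by split=> //; exists `|c|. Qed.

Lemma bmD f h : bm f -> bm h -> bm (fun x => f x + h x).
Proof.
move=> [mf [M fM]] [mh [N hN]]; split; first exact: measurable_funD.
by exists (M + N) => x; rewrite (le_trans (ler_normD _ _))// lerD.
Qed.

Lemma bmM f h : bm f -> bm h -> bm (fun x => f x * h x).
Proof.
move=> [mf [M fM]] [mh [N hN]]; split; first exact: measurable_funM.
by exists (M * N) => x; rewrite normrM ler_pM.
Qed.

Lemma bmZ (c : R) f : bm f -> bm (fun x => c * f x).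
Proof. exact/bmM/bm_cst. Qed.

Lemma bmB f h : bm f -> bm h -> bm (fun x => f x - h x).
Proof.
move=> [mf [M fM]] [mh [N hN]]; split; first exact: measurable_funB.
by exists (M + N) => x; rewrite (le_trans (ler_normB _ _))// lerD.
Qed.

Lemma bm_sqr f : bm f -> bm (fun x => f x ^+ 2).
Proof. by move=> bf; have := bmM bf bf. Qed.

Lemma bm_norm f : bm f -> bm (fun x => `|f x|).
Proof.
move=> [mf [M fM]]; split; first exact: measurableT_comp.
by exists M => x; rewrite normr_id.
Qed.

Lemma bm_indic (A : set (sys_T X)) : measurable A -> bm (\1_A : sys_T X -> R).
Proof.
move=> mA; split; first exact: measurable_indic.
by exists 1 => x; rewrite indicE; case: (x \in A); rewrite ?normr1 ?normr0.
Qed.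

Lemma bm_integrable f : bm f -> (sys_mu X).-integrable setT (EFin \o f).
Proof.
move=> [mf [M fM]]; apply: measurable_bounded_integrable => //.
  by rewrite /= probability_setT ltry.
exists M; split; first exact: num_real.
by move=> N MN x _ /=; exact: le_trans (fM x) (ltW MN).
Qed.

Lemma ExE f : bm f -> (Ex X f)%:E = (\int[sys_mu X]_x (f x)%:E)%E.
Proof. by move=> /bm_integrable bf; rewrite fineK// integrable_fin_num. Qed.

Lemma eq_Ex f h : f =1 h -> Ex X f = Ex X h.
Proof. by move=> fh; congr Ex; exact/funext. Qed.

Lemma ExD f h : bm f -> bm h -> Ex X (fun x => f x + h x) = Ex X f + Ex X h.
Proof. by move=> bf bh; apply: RintegralD => //; exact: bm_integrable. Qed.

Lemma ExB f h : bm f -> bm h -> Ex X (fun x => f x - h x) = Ex X f - Ex X h.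
Proof. by move=> bf bh; apply: RintegralB => //; exact: bm_integrable. Qed.

Lemma ExZ c f : bm f -> Ex X (fun x => c * f x) = c * Ex X f.
Proof. by move=> bf; apply: RintegralZl => //; exact: bm_integrable. Qed.

Lemma Ex_le f h : bm f -> bm h -> (forall x, f x <= h x) -> Ex X f <= Ex X h.
Proof. by move=> bf bh fh; apply: le_Rintegral => //; exact: bm_integrable. Qed.

Lemma Ex_ge0 f : (forall x, 0 <= f x) -> 0 <= Ex X f.
Proof. by move=> f0; exact: Rintegral_ge0. Qed.

Lemma Ex_cst c : Ex X (fun=> c) = c.
Proof. by rewrite /Ex Rintegral_cst//= probability_setT mulr1. Qed.

Lemma Ex_indic (A : set (sys_T X)) : measurable A -> Ex X (\1_A) = fine (sys_mu X A).
Proof. by move=> mA; rewrite /Ex /Rintegral integral_indic// setIT. Qed.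

Lemma Ex_norm_le f : bm f -> `|Ex X f| <= Ex X (fun x => `|f x|).
Proof. by move=> bf; apply: le_normr_Rintegral => //; exact: bm_integrable. Qed.

Lemma integral_indic_Ex f (A : set (sys_T X)) : bm f -> measurable A ->
  (\int[sys_mu X]_(x in A) (f x)%:E)%E = (Ex X (fun x => f x * \1_A x))%:E.
Proof.
move=> bf mA; rewrite ExE; last by apply: bmM => //; exact: bm_indic.
rewrite integral_mkcond; apply: eq_integral => x _.
rewrite patchE indicE; case: ifPn => xA; rewrite ?mulr1 ?mulr0//.
Qed.

(* AM-GM instead of Cauchy-Schwarz: [2 |u| <= u^2 / e + e]. *)
Lemma Ex_norm_le_sqr f (e : R) : bm f -> 0 < e ->
  Ex X (fun x => f x ^+ 2) <= e ^+ 2 -> Ex X (fun x => `|f x|) <= e.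
Proof.
move=> bf e0 fe.
have -> : e = (2 * e)^-1 * e ^+ 2 + e / 2 by field; rewrite gt_eqF.
apply: (@le_trans _ _ ((2 * e)^-1 * Ex X (fun x => f x ^+ 2) + e / 2)).
  rewrite -(ExZ _ (bm_sqr bf)) -[e / 2]Ex_cst.
  rewrite -(ExD (bmZ _ (bm_sqr bf)) (bm_cst _)).
  apply: Ex_le; first exact: bm_norm.
    by apply: bmD; [exact/bmZ/bm_sqr|exact: bm_cst].
  move=> x; rewrite -subr_ge0.
  have -> : (2 * e)^-1 * f x ^+ 2 + e / 2 - `|f x| =
            (2 * e)^-1 * (`|f x| - e) ^+ 2.
    by rewrite -(real_normK (num_real (f x))); field; rewrite gt_eqF.
  by rewrite mulr_ge0 ?sqr_ge0// invr_ge0 mulr_ge0// ltW.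
by rewrite lerD2r ler_wpM2l// invr_ge0 mulr_ge0// ltW.
Qed.

End bounded.

Lemma bm_comp (X Y : system) (p : sys_T X -> sys_T Y) (f : sys_T Y -> R) :
  measurable_fun setT p -> bm f -> bm (fun x => f (p x)).
Proof. by move=> mp [mf [M fM]]; split; [exact: measurableT_comp|exists M]. Qed.

Lemma Ex_factor (X Y : system) (p : sys_T X -> sys_T Y) (f : sys_T Y -> R) :
  factor_map p -> bm f -> Ex X (fun x => f (p x)) = Ex Y f.
Proof.
move=> [mp [pp _]] bf; have [mf _] := bf; apply: EFin_inj.
rewrite !ExE//; last exact: bm_comp.
rewrite -(@eq_measure_integral _ _ _ _ (sys_mu Y) (pushforward (sys_mu X) p));
  last first.
  by move=> A mA _; exact: pp.
rewrite integral_pushforward//; first exact/measurable_EFinP.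
exact/bm_integrable/bm_comp.
Qed.

End expectation.
Arguments Ex {R G} X f.

(** * Best approximation in extensions *)

Section best_approximation.
Context {R : realType} {G : semigroup}.
Local Notation system := (system R G).
Local Notation bm := bounded_measurable.
Variable C : system -> Prop.
Implicit Types X Y : system.

(** These play the role of the bounded functions on the maximal factor in [C]. Factoring holds at
    every point, which keeps null sets out of pullbacks and compositions. *)
Definition class_fun (X : system) (h : sys_T X -> R) : Prop :=
  exists (Y : system) (zeta : sys_T X -> sys_T Y) (h' : sys_T Y -> R),
    [/\ C Y, factor_map zeta, bm h' & h = h' \o zeta].

Arguments class_fun : clear implicits.

Lemma class_fun_bm X (h : sys_T X -> R) : class_fun X h -> bm h.
Proof. by move=> [Y [z [h' [_ [mz _] bh ->]]]]; exact: bm_comp. Qed.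

Lemma class_fun_pullback X Y (p : sys_T X -> sys_T Y) (h : sys_T Y -> R) :
  factor_map p -> class_fun Y h -> class_fun X (fun x => h (p x)).
Proof.
move=> fp [Z [z [h' [CZ fz bh ->]]]]; exists Z, (z \o p), h'; split => //.
exact: factor_map_comp.
Qed.

(** No extension improves the distance attained on [X] by more than [e]. The form with [e] is the
    one the tower delivers and the one that survives limits of [f]; an exact minimizer is recovered
    in [nearly_optimal_minimizer]. *)
Definition nearly_optimal (X : system) (f : sys_T X -> R) : Prop :=
  forall e, 0 < e -> exists2 g, class_fun X g &
  forall (Xt : system) (p : sys_T Xt -> sys_T X), factor_map p ->
  forall h, class_fun Xt h ->
  Ex X (fun x => (f x - g x) ^+ 2) <= Ex Xt (fun x => (f (p x) - h x) ^+ 2) + e.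

Arguments nearly_optimal : clear implicits.

(** The linear counterpart of [nearly_optimal]: for an idempotent class and bounded [f], near
    optimality amounts to the existence of a class function [g] with this property. *)
Definition orthogonal_residual (X : system) (f g : sys_T X -> R) : Prop :=
  forall (Xt : system) (p : sys_T Xt -> sys_T X), factor_map p ->
  forall h, class_fun Xt h ->
  Ex Xt (fun x => (f (p x) - g (p x)) * h x) = 0.

Arguments orthogonal_residual : clear implicits.

(** Clamping a competitor to the bound of [f] never increases its distance to [f], and puts all
    functions under one bound [M], where squared errors are Lipschitz in [L^1]. *)
Definition clamp (M t : R) : R := Num.max (- M) (Num.min M t).

Lemma norm_clamp M t : 0 <= M -> `|clamp M t| <= M.
Proof.
move=> M0; rewrite ler_norml /clamp le_max lexx/= ge_max ge_min lexx/= andbT.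
by rewrite (le_trans _ M0)// oppr_le0.
Qed.

Lemma clamp_sqr M s t : `|s| <= M -> (s - clamp M t) ^+ 2 <= (s - t) ^+ 2.
Proof.
rewrite ler_norml /clamp => /andP[h1 h2].
have [h3|h3] := leP M t; last first.
  rewrite maxEle; case: ifPn => [h4//|]; rewrite -ltNge => h4.
  nra.
rewrite maxEle ifT; [nra|lra].
Qed.

Lemma bm_clamp X M (f : sys_T X -> R) : 0 <= M -> bm f ->
  bm (fun x => clamp M (f x)).
Proof.
move=> M0 [mf _]; split; last by exists M => x; exact: norm_clamp.
by apply: measurable_maxr => //; exact: measurable_minr.
Qed.

Lemma class_fun_clamp X M (h : sys_T X -> R) : 0 <= M -> class_fun X h ->
  class_fun X (fun x => clamp M (h x)).
Proof.
move=> M0 [Y [z [h' [CY fz bh ->]]]].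
by exists Y, z, (fun x => clamp M (h' x)); split => //; exact: bm_clamp.
Qed.

Lemma Ex_clamp X M (f h : sys_T X -> R) : 0 <= M -> (forall x, `|f x| <= M) ->
  bm f -> bm h ->
  Ex X (fun x => (f x - clamp M (h x)) ^+ 2) <= Ex X (fun x => (f x - h x) ^+ 2).
Proof.
move=> M0 fM bf bh; apply: Ex_le.
- by apply: bm_sqr; apply: bmB => //; exact: bm_clamp.
- by apply: bm_sqr; exact: bmB.
- by move=> x; exact: clamp_sqr.
Qed.

(** A difference of squares is the product of the difference and the sum of [f - g] and [f' - g'];
    the sum is at most [4 * M] in absolute value. *)
Lemma Ex_sqr_lipschitz X M (f f' g g' : sys_T X -> R) :
  (forall x, `|f x| <= M) -> (forall x, `|f' x| <= M) ->
  (forall x, `|g x| <= M) -> (forall x, `|g' x| <= M) ->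
  bm f -> bm f' -> bm g -> bm g' ->
  Ex X (fun x => (f x - g x) ^+ 2) <=
  Ex X (fun x => (f' x - g' x) ^+ 2) +
    4 * M * (Ex X (fun x => `|f x - f' x|) + Ex X (fun x => `|g x - g' x|)).
Proof.
move=> fM fM' gM gM' bf bf' bg bg'.
have b1 : bm (fun x => (f' x - g' x) ^+ 2) by apply: bm_sqr; exact: bmB.
have b2 : bm (fun x => `|f x - f' x|) by apply: bm_norm; exact: bmB.
have b3 : bm (fun x => `|g x - g' x|) by apply: bm_norm; exact: bmB.
rewrite -ExD// -ExZ; last exact: bmD.
rewrite -ExD//; last by apply: bmZ; exact: bmD.
apply: Ex_le.
- by apply: bm_sqr; exact: bmB.
- by apply: bmD => //; apply: bmZ; exact: bmD.
move=> x.
have -> : (f x - g x) ^+ 2 = (f' x - g' x) ^+ 2 +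
    ((f x - f' x) - (g x - g' x)) * (f x - g x + (f' x - g' x)) by ring.
rewrite lerD2l (le_trans (ler_norm _))// normrM mulrC ler_pM//.
  rewrite (le_trans (ler_normD _ _))//.
  have := ler_normB (f x) (g x); have := ler_normB (f' x) (g' x).
  have := fM x; have := fM' x; have := gM x; have := gM' x; lra.
exact: ler_normB.
Qed.

Lemma nearly_optimal_closed X M (f : sys_T X -> R) :
  0 <= M -> (forall x, `|f x| <= M) -> bm f ->
  (forall e, 0 < e -> exists f' : sys_T X -> R,
    [/\ bm f', forall x, `|f' x| <= M, nearly_optimal X f'
      & Ex X (fun x => `|f x - f' x|) <= e]) ->
  nearly_optimal X f.
Proof.
move=> M0 fM bf approx e e0.
(* Replacing [f] by [f'] on [X] and back on the extension costs [4 * M * del] each time, and the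
   near optimality of [f'] costs [del]. *)
pose del := e / (8 * M + 1).
have del0 : 0 < del by rewrite divr_gt0// ltr_wpDl// mulr_ge0.
have [f' [bf' fM' nf' ff']] := approx _ del0.
have [g cg gopt] := nf' _ del0.
have bg := class_fun_bm cg.
exists (fun x => clamp M (g x)); first exact: class_fun_clamp.
move=> Xt p fp h ch; have bh := class_fun_bm ch; have [mp _] := fp.
have Exz Z (u : sys_T Z -> R) : Ex Z (fun x => `|u x - u x|) = 0.
  by rewrite -[RHS](Ex_cst Z); apply: eq_Ex => x; rewrite subrr normr0.
have h1 : Ex X (fun x => (f x - clamp M (g x)) ^+ 2) <=
    Ex X (fun x => (f' x - clamp M (g x)) ^+ 2) + 4 * M * del.
  apply: le_trans (Ex_sqr_lipschitz (M := M) _ _ _ _ bf bf' (bm_clamp M0 bg)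
    (bm_clamp M0 bg)) _ => //; try by move=> x; exact: norm_clamp.
  by rewrite Exz addr0 lerD2l ler_wpM2l// mulr_ge0.
have h2 := Ex_clamp M0 fM' bf' bg.
have h3 := gopt _ _ fp _ (class_fun_clamp M0 ch).
have bfp := bm_comp mp bf; have bfp' := bm_comp mp bf'.
have h4 : Ex Xt (fun x => (f' (p x) - clamp M (h x)) ^+ 2) <=
    Ex Xt (fun x => (f (p x) - clamp M (h x)) ^+ 2) + 4 * M * del.
  apply: le_trans (Ex_sqr_lipschitz (M := M) _ _ _ _ bfp' bfp (bm_clamp M0 bh)
    (bm_clamp M0 bh)) _ => //; try by move=> x; exact: norm_clamp.
  rewrite Exz addr0 lerD2l ler_wpM2l ?mulr_ge0//.
  rewrite (eq_Ex (h := fun x => `|f (p x) - f' (p x)|)).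
    rewrite (@Ex_factor _ _ _ _ _ (fun y => `|f y - f' y|))//.
    by apply: bm_norm; exact: bmB.
  by move=> x; rewrite distrC.
have h5 : Ex Xt (fun x => (f (p x) - clamp M (h x)) ^+ 2) <=
  Ex Xt (fun x => (f (p x) - h x) ^+ 2) by apply: Ex_clamp.
have ee : e = (8 * M + 1) * del.
  by rewrite /del mulrC divfK// gt_eqF// ltr_wpDl// mulr_ge0.
rewrite [X in _ + X]ee; lra.
Qed.

End best_approximation.
Arguments class_fun {R G} C X h.
Arguments nearly_optimal {R G} C X f.
Arguments orthogonal_residual {R G} C X f g.

(** * Limits of fast Cauchy sequences *)

Section completeness.
Context {R : realType} {G : semigroup}.
Local Notation bm := bounded_measurable.

Lemma limn_sup_bounds (u : nat -> R) (M a b : R) n :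
  (forall m, `|u m| <= M) -> (forall m, (n <= m)%N -> a <= u m <= b) ->
  a <= limn_sup u <= b.
Proof.
move=> uM uab.
have ub : has_ubound (range u).
  by exists M => _ [m _ <-]; have := uM m; rewrite ler_norml => /andP[].
have lb : has_lbound (range u).
  by exists (- M) => _ [m _ <-]; have := uM m; rewrite ler_norml => /andP[].
have cv : cvgn (sups u) by apply/cvg_ex; eexists; exact: cvg_sups_inf.
have au m : (n <= m)%N -> a <= u m by move=> /uab /andP[].
have bu m : (n <= m)%N -> u m <= b by move=> /uab /andP[].
apply/andP; split.
- apply: limr_ge => //; near=> m; apply: (@le_trans _ _ (u m)).
    by apply: au; near: m; exact: nbhs_infty_ge.
  by apply: ub_le_sup; [exact: has_ubound_sdrop|exists m => /=].
- apply: limr_le => //; near=> m; apply: ge_sup.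
    by exists (u m), m => /=.
  move=> _ [j /= mj <-]; apply: bu; apply: leq_trans mj.
  by near: m; exact: nbhs_infty_ge.
Unshelve. all: by end_near. Qed.

(** Telescoping. With the upper limit the bound holds at every point: where the series diverges, the
    right side is infinite. *)
Lemma norm_limn_sup_sub (u : nat -> R) (M : R) n :
  (forall m, `|u m| <= M) ->
  (`|limn_sup u - u n|%:E <=
   \sum_(0 <= i <oo) `|u (i + n).+1 - u (i + n)%N|%:E)%E.
Proof.
move=> uM; set S := (\sum_(0 <= i <oo) _)%E.
have part j : (`|u (j + n)%N - u n|%:E <=
    \sum_(0 <= i < j) `|u (i + n).+1 - u (i + n)%N|%:E)%E.
  elim: j => [|j IHj]; first by rewrite subrr normr0 big_geq.
  rewrite big_nat_recr//= (le_trans _ (leeD IHj (lexx _)))//.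
  rewrite -EFinD lee_fin addSn.
  have -> : u (j + n).+1 - u n =
    (u (j + n)%N - u n) + (u (j + n).+1 - u (j + n)%N) by ring.
  exact: ler_normD.
have S0 : (0 <= S)%E by apply: nneseries_ge0.
have [Soo|Sfin] := eqVneq S +oo%E; first by rewrite Soo leey.
have Sf : S \is a fin_num by rewrite ge0_fin_numE// ltey.
rewrite -(fineK Sf) lee_fin ler_distl.
apply: (@limn_sup_bounds u M _ _ n) => // m nm.
rewrite -ler_distl -lee_fin (fineK Sf).
have := part (m - n)%N; rewrite subnK// => /le_trans; apply.
by apply: nneseries_lim_ge.
Qed.

Lemma bm_limn_sup (X : system R G) (M : R) (k : nat -> sys_T X -> R) :
  (forall n, bm (k n)) -> (forall n x, `|k n x| <= M) ->
  bm (fun x => limn_sup (k ^~ x)) /\ forall x, `|limn_sup (k ^~ x)| <= M.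
Proof.
move=> bk kM.
have gM x : `|limn_sup (k ^~ x)| <= M.
  rewrite ler_norml; apply: (@limn_sup_bounds _ M _ _ 0%N) => // m _.
  by rewrite -ler_norml.
split=> //; split; last by exists M.
apply: measurable_fun_limn_sup => [x _|x _|n]; last by case: (bk n).
- by exists M => _ [m _ <-]; have := kM m x; rewrite ler_norml => /andP[].
- by exists (- M) => _ [m _ <-]; have := kM m x; rewrite ler_norml => /andP[].
Qed.

(** The telescoping bound is integrated term by term, and the increments from [n] on add up to
    [4 / 2 ^+ n]. The limit is formed pointwise, so a limit of functions on a factor is a function
    on the same factor. *)
Lemma Ex_fast_cauchy (X : system R G) (M : R) (k : nat -> sys_T X -> R) :
  (forall n, bm (k n)) -> (forall n x, `|k n x| <= M) ->
  (forall n, Ex X (fun x => `|k n.+1 x - k n x|) <= 4 / (2 ^ n.+1)%:R) ->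
  forall n, Ex X (fun x => `|limn_sup (k ^~ x) - k n x|) <= 4 / 2 ^+ n.
Proof.
move=> bk kM kC n; have [bg gM] := bm_limn_sup bk kM.
have bd i : bm (fun x => `|k (i + n).+1 x - k (i + n)%N x|).
  by apply: bm_norm; exact: bmB.
have mEd i : measurable_fun setT (fun x => `|k (i + n).+1 x - k (i + n)%N x|%:E).
  by apply/measurable_EFinP; case: (bd i).
rewrite -lee_fin ExE; last by apply: bm_norm; exact: bmB.
apply: (@le_trans _ _ (\int[sys_mu X]_x
    \sum_(0 <= i <oo) `|k (i + n).+1 x - k (i + n)%N x|%:E)%E).
  apply: ge0_le_integral => //.
  - by apply/measurable_EFinP; case: (bm_norm (bmB bg (bk n))).
  - exact: ge0_emeasurable_sum.
  - by move=> x _; exact: (norm_limn_sup_sub n (kM ^~ x)).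
rewrite integral_nneseries//.
have <- : (\sum_(0 <= i <oo) (4 / (2 ^ (i + n.+1))%:R : R)%:E)%E =
    (4 / 2 ^+ n)%:E by apply/cvg_lim => //; exact: cvg_geometric_eseries_half.
apply: lee_nneseries => i *; first exact: integral_ge0.
by rewrite -ExE// lee_fin addnS; exact: kC.
Qed.

Lemma le_of_geometric (a b K : R) :
  (forall n, a <= b + K / 2 ^+ n) -> a <= b.
Proof.
move=> h; rewrite leNgt; apply/negP => ba.
pose n := Num.bound `|K / (a - b)|.
have ab0 : 0 < a - b by rewrite subr_gt0.
have Kn : K / (a - b) < 2 ^+ n.
  apply: (le_lt_trans (ler_norm _)); apply: (lt_le_trans (archi_boundP _)) => //.
  by rewrite -natrX ler_nat ltnW// ltn_expl.
have := h n; rewrite leNgt => /negP; apply.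
by rewrite -ltrBrDl ltr_pdivrMr ?exprn_gt0// mulrC -ltr_pdivrMr.
Qed.

End completeness.

(** * Projection onto the functions of an idempotent class *)

Section idempotent.
Context {R : realType} {G : semigroup}.
Local Notation system := (system R G).
Local Notation bm := bounded_measurable.
Variable C : system -> Prop.
Hypothesis idC : idempotent_class C.
Implicit Types X Y : system.

(** By [countable_join], countably many class functions are realized on a single member of [C],
    where they can be combined and passed to the limit. *)
Lemma class_fun_common X (h : nat -> sys_T X -> R) :
  (forall n, class_fun C X (h n)) ->
  exists (Z : system) (xi : sys_T X -> sys_T Z) (h' : nat -> sys_T Z -> R),
    [/\ C Z, factor_map xi, forall n, bm (h' n) & forall n, h n = h' n \o xi].
Proof.
move=> ch.
pose w1 n := cid (ch n); pose Y n := sval (w1 n).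
pose w2 n := cid (svalP (w1 n)); pose z n := sval (w2 n).
pose w3 n := cid (svalP (w2 n)); pose k n := sval (w3 n).
have wP n : [/\ C (Y n), factor_map (z n), bm (k n) & h n = k n \o z n].
  exact: (svalP (w3 n)).
have CY n : C (Y n) by case: (wP n).
have fz n : factor_map (z n) by case: (wP n).
have [Z [xi [r [CZ fxi mr rz]]]] := countable_join idC CY fz.
exists Z, xi, (fun n => k n \o r n); split => // n.
  by apply: bm_comp => //; case: (wP n).
have [_ _ _ hE] := wP n; apply: (etrans hE); apply/funext => x /=.
by rewrite rz.
Qed.

Lemma class_fun_op2 X (op : R -> R -> R) (h k : sys_T X -> R) :
  (forall (Z : system) (u v : sys_T Z -> R), bm u -> bm v ->
    bm (fun z => op (u z) (v z))) ->
  class_fun C X h -> class_fun C X k -> class_fun C X (fun x => op (h x) (k x)).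
Proof.
move=> bop ch ck.
have [|Z [xi [u [CZ fxi bu uE]]]] :=
  @class_fun_common X (fun n => if n is 0%N then h else k); first by case.
exists Z, xi, (fun z => op (u 0%N z) (u 1%N z)); split => //; first exact: bop.
by have := uE 0%N; have := uE 1%N => /= -> ->.
Qed.

Lemma class_funD X (a b : R) (h k : sys_T X -> R) : class_fun C X h ->
  class_fun C X k -> class_fun C X (fun x => a * h x + b * k x).
Proof.
apply: (@class_fun_op2 X (fun s t => a * s + b * t)) => Z u v bu bv.
by apply: bmD; exact: bmZ.
Qed.

Lemma class_funB X (h k : sys_T X -> R) : class_fun C X h ->
  class_fun C X k -> class_fun C X (fun x => h x - k x).
Proof. by apply: (@class_fun_op2 X (fun s t => s - t)) => *; exact: bmB. Qed.

Lemma class_fun_cst X (c : R) : class_fun C X (fun=> c).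
Proof.
have [[T [CT Tsub]] _] := idC.
exists T, (fun=> point), (fun=> c); split=> //; last exact: bm_cst.
split=> //; split=> [B mB|g x]; last exact: Tsub.
have [BT|BN] := pselect (B point).
  rewrite (_ : _ @^-1` _ = setT) ?probability_setT; last first.
    by apply/seteqP; split.
  rewrite (_ : B = setT) ?probability_setT//.
  by apply/seteqP; split=> // y _; rewrite (Tsub y point).
rewrite (_ : _ @^-1` _ = set0) ?measure0; last by apply/seteqP; split.
rewrite (_ : B = set0) ?measure0//.
by apply/seteqP; split=> // y By; apply: BN; rewrite (Tsub point y).
Qed.

(** Pythagoras: on an extension, [f - h] splits into [f - g] and [g - h], and the cross term
    vanishes because [g - h] is a class function there. *)
Lemma orthogonal_nearly_optimal X (f g : sys_T X -> R) :
  bm f -> class_fun C X g -> orthogonal_residual C X f g ->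
  nearly_optimal C X f.
Proof.
move=> bf cg og e e0; exists g => // Xt p fp h ch.
have bg := class_fun_bm cg; have bh := class_fun_bm ch.
have [mp _] := fp.
have bfp := bm_comp mp bf; have bgp := bm_comp mp bg.
rewrite -(@Ex_factor _ _ _ _ p (fun y => (f y - g y) ^+ 2))//; last first.
  by apply: bm_sqr; exact: bmB.
have cgh : class_fun C Xt (fun x => g (p x) - h x).
  by apply: class_funB => //; exact: (class_fun_pullback fp).
have o := og _ _ fp _ cgh.
have bfg := bmB bfp bgp; have bgh := bmB bgp bh.
rewrite (eq_Ex (X := Xt) (f := fun x => (f (p x) - h x) ^+ 2)
  (h := fun x => (f (p x) - g (p x)) ^+ 2 +
    (2 * ((f (p x) - g (p x)) * (g (p x) - h x)) + (g (p x) - h x) ^+ 2)));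
  last first.
  by move=> x; ring.
rewrite ExD; [|exact: bm_sqr|by apply: bmD; [apply: bmZ; exact: bmM|exact: bm_sqr]].
rewrite ExD; [|by apply: bmZ; exact: bmM|exact: bm_sqr].
rewrite ExZ; last exact: bmM.
rewrite o mulr0 add0r -addrA lerDl addr_ge0//; last exact: ltW.
by apply: Ex_ge0 => x; exact: sqr_ge0.
Qed.

(** Near minimizers form a Cauchy sequence, as in the projection theorem in Hilbert space. They are
    realized on one factor [Z] in [C], so their limit is again a class function. *)
Lemma nearly_optimal_minimizer X (f : sys_T X -> R) : bm f ->
  nearly_optimal C X f ->
  exists2 g, class_fun C X g &
  forall (Xt : system) (p : sys_T Xt -> sys_T X), factor_map p ->
  forall h, class_fun C Xt h ->
  Ex X (fun x => (f x - g x) ^+ 2) <= Ex Xt (fun x => (f (p x) - h x) ^+ 2).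
Proof.
move=> bf nf; have [mf [M0 fM0]] := bf; pose M : R := `|M0|.
have M_ge0 : 0 <= M by exact: normr_ge0.
have fM x : `|f x| <= M by rewrite (le_trans (fM0 x))// ler_norm.
(* Errors of squares: [4^-n] here yields distances of order [2^-n], which are summable. *)
pose eps n : R := 4^-1 ^+ n.
have eps0 n : 0 < eps n by rewrite exprn_gt0.
have /choice[u uP] : forall n, exists u, class_fun C X u /\
    forall (Xt : system) (p : sys_T Xt -> sys_T X), factor_map p ->
    forall h, class_fun C Xt h -> Ex X (fun x => (f x - u x) ^+ 2) <=
      Ex Xt (fun x => (f (p x) - h x) ^+ 2) + eps n.
  by move=> n; have [u cu uo] := nf _ (eps0 n); exists u.
have [|Z [xi [v [CZ fxi bv uv]]]] := @class_fun_common X u.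
  by move=> n; case: (uP n).
pose k n z := clamp M (v n z).
have bk n : bm (k n) by exact: bm_clamp.
have kM n z : `|k n z| <= M by exact: norm_clamp.
have [mxi _] := fxi.
have bkx n : bm (fun x => k n (xi x)) by exact: bm_comp.
have ck n : class_fun C X (fun x => k n (xi x)) by exists Z, xi, (k n).
have kopt n (Xt : system) (p : sys_T Xt -> sys_T X) : factor_map p ->
    forall h, class_fun C Xt h -> Ex X (fun x => (f x - k n (xi x)) ^+ 2) <=
      Ex Xt (fun x => (f (p x) - h x) ^+ 2) + eps n.
  move=> fp h ch; have [cu uo] := uP n.
  apply: le_trans (uo _ _ fp _ ch).
  have := Ex_clamp M_ge0 fM bf (class_fun_bm cu).
  by rewrite !(uv n).
have kC n : Ex Z (fun z => `|k n.+1 z - k n z|) <= 4 / (2 ^ n.+1)%:R.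
  rewrite -(Ex_factor fxi); last by apply: bm_norm; exact: bmB.
  apply: Ex_norm_le_sqr; [exact: bmB|by rewrite divr_gt0// ltr0n expn_gt0|].
  (* Parallelogram identity, with the midpoint as competitor: the squared distance is at most
     [2 * eps n.+1 + 2 * eps n], below [4 * eps n], the square of the claimed bound. *)
  pose mid x := 2^-1 * k n.+1 (xi x) + 2^-1 * k n (xi x).
  have cm : class_fun C X mid by exact: class_funD.
  have bm_mid := class_fun_bm cm.
  have h1 := kopt n _ _ (factor_map_id X) _ cm.
  have h2 := kopt n.+1 _ _ (factor_map_id X) _ cm.
  have b1 n' : bm (fun x => (f x - k n' (xi x)) ^+ 2).
    by apply: bm_sqr; exact: bmB.
  have b2 : bm (fun x => (f x - mid x) ^+ 2) by apply: bm_sqr; exact: bmB.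
  rewrite (eq_Ex (h := fun x => (2 * (f x - k n.+1 (xi x)) ^+ 2 +
     2 * (f x - k n (xi x)) ^+ 2) - 4 * (f x - mid x) ^+ 2)); last first.
    by move=> x; rewrite /mid; field.
  rewrite ExB ?ExD ?ExZ//; try exact: bmZ; last by apply: bmD; exact: bmZ.
  have -> : (4 / (2 ^ n.+1)%:R) ^+ 2 = 4 * eps n.
    have four : 2 ^+ 2 = 4 :> R by ring.
    rewrite natrX exprMn exprVn exprAC four (exprS 4 n) /eps exprVn.
    by field; rewrite expf_neq0.
  have e4 : eps n.+1 = 4^-1 * eps n by rewrite /eps exprS.
  have := eps0 n; lra.
have [bg gM] := bm_limn_sup bk kM.
have gC := Ex_fast_cauchy bk kM kC.
pose g x := limn_sup (k ^~ (xi x)).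
have bgx : bm g by exact: (bm_comp mxi bg).
exists g; first by exists Z, xi, (fun z => limn_sup (k ^~ z)).
move=> Xt p fp h ch.
(* The 1 pays for [eps n], and [16 * M] is the Lipschitz constant [4 * M] times the 4 in the
   distance from [k n] to the limit. *)
apply: (@le_of_geometric _ _ _ (1 + 16 * M)) => n.
have h1 := kopt n _ _ fp _ ch.
have h2 : Ex X (fun x => `|g x - k n (xi x)|) <= 4 / 2 ^+ n.
  rewrite (@Ex_factor _ _ _ _ xi (fun z => `|limn_sup (k ^~ z) - k n z|))//.
  by apply: bm_norm; exact: bmB.
have h3 : Ex X (fun x => (f x - g x) ^+ 2) <=
    Ex X (fun x => (f x - k n (xi x)) ^+ 2) + 4 * M * (0 + 4 / 2 ^+ n).
  apply: le_trans (Ex_sqr_lipschitz (M := M) fM fM _ _ bf bf bgx (bkx n)) _.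
  - by move=> x; exact: gM.
  - by move=> x; exact: kM.
  rewrite lerD2l ler_wpM2l ?mulr_ge0// lerD//.
  rewrite (eq_Ex (h := fun=> 0)) ?Ex_cst// => x.
  by rewrite subrr normr0.
have h4 : eps n <= (2 ^+ n)^-1.
  rewrite /eps -exprVn; apply: lerXn2r; rewrite ?nnegrE; lra.
rewrite mulrDl mul1r; move: h3; rewrite add0r mulrA.
rewrite (_ : 4 * M * 4 = 16 * M); last by ring.
move=> h3; lra.
Qed.

(** First variation: comparing the minimizer [g] with [g + t h] on the extension gives
    [2 t c <= t ^ 2 q] for all real [t], which forces the correlation [c] to vanish. *)
Lemma nearly_optimal_orthogonal X (f : sys_T X -> R) : bm f ->
  nearly_optimal C X f ->
  exists2 g, class_fun C X g & orthogonal_residual C X f g.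
Proof.
move=> bf nf; have [g cg gmin] := nearly_optimal_minimizer bf nf.
exists g => // Xt p fp h ch; have [mp _] := fp.
have bg := class_fun_bm cg; have bh := class_fun_bm ch.
have bfp := bm_comp mp bf; have bgp := bm_comp mp bg.
have bu := bmB bfp bgp.
set c := Ex _ _; set q := Ex Xt (fun x => h x ^+ 2).
have q0 : 0 <= q by apply: Ex_ge0 => x; exact: sqr_ge0.
have key t : 2 * t * c <= t ^+ 2 * q.
  have cgp : class_fun C Xt (fun x => 1 * g (p x) + t * h x).
    by apply: class_funD => //; exact: (class_fun_pullback fp).
  have := gmin _ _ fp _ cgp.
  rewrite -(@Ex_factor _ _ _ _ p (fun y => (f y - g y) ^+ 2))//; last first.
    by apply: bm_sqr; exact: bmB.
  rewrite [X in _ <= X](eq_Ex (h := fun x => ((f (p x) - g (p x)) ^+ 2 +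
     (- (2 * t)) * ((f (p x) - g (p x)) * h x)) + t ^+ 2 * h x ^+ 2)); last first.
    by move=> x; ring.
  have b1 := bm_sqr bu; have b2 := bmM bu bh; have b3 := bm_sqr bh.
  rewrite ExD; [|by apply: bmD => //; exact: bmZ|exact: bmZ].
  rewrite ExD//; last exact: bmZ.
  by rewrite !ExZ// -/c -/q; lra.
apply/eqP; rewrite -sqrf_eq0 eq_le sqr_ge0 andbT.
have q1 : 0 < q + 1 by rewrite ltr_wpDl.
(* The choice [t = c / q] would be natural, but [q] may be 0; with [q + 1] the coefficient of
   [c ^+ 2] is still negative. *)
have := key (c / (q + 1)).
rewrite -subr_ge0.
have -> : (c / (q + 1)) ^+ 2 * q - 2 * (c / (q + 1)) * c =
   - ((q + 2) / (q + 1) ^+ 2) * c ^+ 2 by field; rewrite gt_eqF.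
rewrite mulNr oppr_ge0 pmulr_rle0// divr_gt0 ?exprn_gt0//; lra.
Qed.

(** Linearity becomes visible after passing to orthogonal residuals, which add up. *)
Lemma nearly_optimalD X (a b : R) (f1 f2 : sys_T X -> R) : bm f1 -> bm f2 ->
  nearly_optimal C X f1 -> nearly_optimal C X f2 ->
  nearly_optimal C X (fun x => a * f1 x + b * f2 x).
Proof.
move=> bf1 bf2 /(nearly_optimal_orthogonal bf1)[g1 cg1 o1].
move=> /(nearly_optimal_orthogonal bf2)[g2 cg2 o2].
apply: (@orthogonal_nearly_optimal _ _ (fun x => a * g1 x + b * g2 x)).
- by apply: bmD; exact: bmZ.
- exact: class_funD.
move=> Xt p fp h ch; have [mp _] := fp.
have bg1 := class_fun_bm cg1; have bg2 := class_fun_bm cg2.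
have bh := class_fun_bm ch.
have b1 := bmM (bmB (bm_comp mp bf1) (bm_comp mp bg1)) bh.
have b2 := bmM (bmB (bm_comp mp bf2) (bm_comp mp bg2)) bh.
rewrite (eq_Ex (h := fun x => a * ((f1 (p x) - g1 (p x)) * h x) +
   b * ((f2 (p x) - g2 (p x)) * h x))); last by move=> x; ring.
rewrite ExD; [|exact: bmZ|exact: bmZ].
by rewrite !ExZ// o1// o2// !mulr0 addr0.
Qed.

Lemma nearly_optimal_cst X (c : R) : nearly_optimal C X (fun=> c).
Proof.
apply: (@orthogonal_nearly_optimal _ _ (fun=> c)); first exact: bm_cst.
  exact: class_fun_cst.
move=> Xt p fp h ch; rewrite -[RHS](Ex_cst Xt).
by apply: eq_Ex => x; rewrite subrr mul0r.
Qed.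

End idempotent.

(** * From cylinders to satedness *)

Section satedness.
Context {R : realType} {G : semigroup}.
Local Notation system := (system R G).
Local Notation bm := bounded_measurable.
Variable C : system -> Prop.
Hypothesis idC : idempotent_class C.
Variable X : system.

Lemma norm_indic_le1 (A : set (sys_T X)) x : `|\1_A x : R| <= 1.
Proof. by rewrite indicE; case: (_ \in _); rewrite ?normr1 ?normr0. Qed.

Lemma nearly_optimal_eq (f g : sys_T X -> R) : f =1 g ->
  nearly_optimal C X f -> nearly_optimal C X g.
Proof. by move=> /funext ->. Qed.

(** Dynkin's theorem: complements and finite disjoint unions follow from linearity, countable
    disjoint unions from closedness under [L^1]-limits. *)
Lemma nearly_optimal_indic (F : set (set (sys_T X))) :
  @measurable _ (sys_T X) = <<s F >> -> setI_closed F ->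
  (forall A, F A -> nearly_optimal C X (\1_A : sys_T X -> R)) ->
  forall A, measurable A -> nearly_optimal C X (\1_A : sys_T X -> R).
Proof.
move=> mF FI Fopt A mA; have sA : <<s F >> A by rewrite -mF.
apply: (@dynkin_induction _ (sys_T X) F
  (fun A => nearly_optimal C X (\1_A : sys_T X -> R))) sA => //.
- apply: (@nearly_optimal_eq (fun=> 1)); last exact: nearly_optimal_cst.
  by move=> x; rewrite indicT.
- move=> S mS oS.
  apply: (@nearly_optimal_eq (fun x => 1 * 1 + (-1) * \1_S x)).
    by move=> x; rewrite !indicE in_setC; case: (_ \in _) => /=; ring.
  apply: (@nearly_optimalD _ _ _ idC X 1 (-1) (fun=> 1) (\1_S)) => //.
    exact: bm_cst.
    exact: bm_indic.
  exact: nearly_optimal_cst.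
move=> E mE tE oE.
pose U n := \big[setU/set0]_(i < n.+1) E i.
have mU n : measurable (U n) by exact: bigsetU_measurable.
have UE : \bigcup_n U n = \bigcup_n E n by exact: bigcup_bigsetU_bigcup.
have mUE : measurable (\bigcup_n E n) by exact: bigcupT_measurable.
have oU n : nearly_optimal C X (\1_(U n) : sys_T X -> R).
  elim: n => [|n IHn]; first by rewrite /U big_ord_recl big_ord0 setU0.
  apply: (@nearly_optimal_eq (fun x => 1 * \1_(U n) x + 1 * \1_(E n.+1) x)).
    move=> x; rewrite !mul1r /U [in RHS]big_ord_recr/= -/(U n) !indicE in_setU.
    have [xU|xU] := boolP (x \in U n); rewrite /= ?add0r//.
    rewrite memNset ?addr0// => En.
    move: xU; rewrite inE => xU.
    have /trivIsetP/(_ n.+1) := tE.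
    move: xU; rewrite /U -bigcup_mkord => -[i /= ni Ei].
    move=> /(_ i Logic.I Logic.I); rewrite neq_ltn ni orbT => /(_ isT).
    by move=> /seteqP[/(_ x) + _]; apply.
  by apply: (nearly_optimalD idC) => //; exact: bm_indic.
apply: (@nearly_optimal_closed _ _ _ _ 1) => //.
- by move=> x; exact: norm_indic_le1.
- exact: bm_indic.
move=> e e0.
have UsubE n : U n `<=` \bigcup_n E n by move=> x Ux; rewrite -UE; exists n.
(* Continuity from below turns the finite unions into [L^1]-approximations of the whole union. *)
have cv : (fun n => fine (sys_mu X (U n))) @ \oo --> fine (sys_mu X (\bigcup_n E n)).
  apply: fine_cvg; rewrite fineK; last exact: fin_num_measure.
  rewrite -UE; apply: nondecreasing_cvg_mu => //; first by rewrite UE.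
  by move=> m n mn; apply/subsetPset; exact: subset_bigsetU.
have [n hn] : exists n, fine (sys_mu X (\bigcup_n E n)) - fine (sys_mu X (U n)) <= e.
  have /cvgrPdist_le/(_ e e0)[n _ /(_ n (leqnn n)) h] := cv.
  by exists n; exact: le_trans (ler_norm _) h.
exists (\1_(U n)); split => //; first exact: bm_indic.
  by move=> x; exact: norm_indic_le1.
rewrite (eq_Ex (h := fun x => \1_(\bigcup_n E n) x - \1_(U n) x)); last first.
  move=> x; rewrite ger0_norm// subr_ge0 !indicE.
  have [xU|//] := boolP (x \in U n).
  by rewrite mem_set//; exact: (UsubE n _ (set_mem xU)).
by rewrite ExB ?Ex_indic//; exact: bm_indic.
Qed.

Hypothesis indic_opt :
  forall A, measurable A -> nearly_optimal C X (\1_A : sys_T X -> R).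

(* Peeling off the leading binary digit of [f] reduces the error by half. *)
Lemma dyadic_approximation n (f : sys_T X -> R) :
  bm f -> (forall x, 0 <= f x <= 1) ->
  exists f' : sys_T X -> R, [/\ bm f', forall x, 0 <= f' x <= 1,
    nearly_optimal C X f' & forall x, `|f x - f' x| <= (2 ^+ n)^-1].
Proof.
elim: n f => [|n IHn] f bf f01.
  exists (fun=> 0); split.
  - exact: bm_cst.
  - by move=> x; rewrite lexx ler01.
  - exact: nearly_optimal_cst.
  - move=> x; rewrite subr0 expr0 invr1.
    by have /andP[h0 h1] := f01 x; rewrite ger0_norm.
pose B := f @^-1` `[2^-1, +oo[%classic.
have mB : measurable B.
  by apply: measurable_preimage; [case: bf|exact: measurable_itv].
have BE x : (\1_B x : R) = (2^-1 <= f x)%R%:R.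
  rewrite indicE; congr (_%:R); congr nat_of_bool.
  apply/idP/idP; rewrite inE /B /= in_itv/= andbT//.
have bB : bm (\1_B : sys_T X -> R) by exact: bm_indic.
have [||f1 [bf1 f101 of1 ff1]] := IHn (fun x => 2 * f x - \1_B x).
- by apply: bmB => //; exact: bmZ.
- move=> x; have /andP[h0 h1] := f01 x; rewrite BE.
  by case: (leP 2^-1 (f x)) => /= h2; apply/andP; split; lra.
exists (fun x => 2^-1 * \1_B x + 2^-1 * f1 x); split.
- by apply: bmD; exact: bmZ.
- move=> x; have /andP[h0 h1] := f101 x; rewrite BE.
  by case: (leP 2^-1 (f x)) => /= h2; apply/andP; split; lra.
- by apply: (nearly_optimalD idC) => //; exact: indic_opt.
- move=> x; have -> : f x - (2^-1 * \1_B x + 2^-1 * f1 x) =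
     2^-1 * ((2 * f x - \1_B x) - f1 x) by field.
  rewrite normrM ger0_norm// exprS invfM ler_wpM2l//.
Qed.

(** An affine map brings [f] into the unit interval, where dyadic approximations are uniform;
    linearity undoes it. *)
Lemma nearly_optimal_bounded (f : sys_T X -> R) : bm f -> nearly_optimal C X f.
Proof.
(* The added 1 keeps [M] positive, as the rescaling divides by it. *)
move=> bf; have [_ [M0 fM0]] := bf; pose M : R := `|M0| + 1.
have M1 : 0 < M by rewrite ltr_wpDl.
have fM x : `|f x| <= M.
  by rewrite (le_trans (fM0 x))// (le_trans (ler_norm _))// lerDl.
pose u x := (2 * M)^-1 * f x + 2^-1 * 1.
have bu : bm u by apply: bmD; [exact: bmZ|exact: bm_cst].
have u01 x : 0 <= u x <= 1.
  have := fM x; rewrite ler_norml => /andP[h0 h1].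
  have -> : u x = (f x + M) / (2 * M) by rewrite /u; field; rewrite gt_eqF.
  have M2 : 0 < 2 * M by rewrite mulr_gt0.
  apply/andP; split; last by rewrite ler_pdivrMr//; lra.
  by rewrite divr_ge0//; lra.
apply: (@nearly_optimal_eq (fun x => 2 * M * u x + (- M) * 1)).
  by move=> x; rewrite /u; field; rewrite gt_eqF.
apply: (@nearly_optimalD _ _ _ idC X _ _ u (fun=> 1)) => //.
- exact: bm_cst.
- apply: (@nearly_optimal_closed _ _ _ _ 1) => //.
    by move=> x; have /andP[h0 h1] := u01 x; rewrite ger0_norm.
  move=> e e0.
  have [n en] : exists n, (2 ^+ n)^-1 <= e :> R.
    apply: contrapT => h; suff : e <= 0 by rewrite leNgt e0.
    apply: (@le_of_geometric _ _ _ 1) => n; rewrite add0r div1r leNgt.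
    by apply/negP => /ltW h'; apply: h; exists n.
  have [f' [bf' f'01 of' ff']] := dyadic_approximation n bu u01.
  exists f'; split => //.
    by move=> x; have /andP[h0 h1] := f'01 x; rewrite ger0_norm.
  rewrite -[e](Ex_cst X); apply: Ex_le.
  + by apply: bm_norm; exact: bmB.
  + exact: bm_cst.
  + by move=> x; exact: le_trans (ff' x) en.
- exact: nearly_optimal_cst.
Qed.

End satedness.

(** * From orthogonal residuals to conditional expectations *)

Section sated.
Context {R : realType} {G : semigroup}.
Local Notation system := (system R G).
Local Notation bm := bounded_measurable.

Lemma Ex_indic_mod0 (X : system) (u : sys_T X -> R) (A B : set (sys_T X)) :
  bm u -> measurable A -> measurable B -> sys_mu X (symdiff A B) = 0%E ->
  Ex X (fun x => u x * \1_A x) = Ex X (fun x => u x * \1_B x).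
Proof.
move=> bu mA mB AB; apply/eqP; rewrite -subr_eq0 -normr_le0.
have bA : bm (\1_A : sys_T X -> R) := bm_indic mA.
have bB : bm (\1_B : sys_T X -> R) := bm_indic mB.
have bAB := bm_indic (symdiff_measurable mA mB).
have [_ [M uM]] := bu.
rewrite -ExB; [|exact: bmM|exact: bmM].
apply: (le_trans (Ex_norm_le _)); first by apply: bmB; exact: bmM.
have -> : 0 = Ex X (fun x => M * \1_(symdiff A B) x).
  by rewrite ExZ// Ex_indic ?AB/= ?mulr0//; exact: symdiff_measurable.
apply: Ex_le; [by apply: bm_norm; apply: bmB; exact: bmM|exact: bmZ|].
move=> x; rewrite -mulrBr normrM ler_pM//.
rewrite !indicE /symdiff in_setU !in_setD.
by case: (x \in A); case: (x \in B);
  rewrite /= ?subrr ?subr0 ?sub0r ?normrN ?normr0 ?normr1.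
Qed.

(** The indicator of a set of the maximal factor agrees up to a null set with a class function, so
    orthogonality to class functions contains the defining identity of the conditional
    expectation. *)
Lemma cond_exp_version_orthogonal C (X : system) (f g : sys_T X -> R) :
  bm f -> class_fun C X g ->
  (forall h, class_fun C X h -> Ex X (fun x => (f x - g x) * h x) = 0) ->
  cond_exp_version X (max_factor C X) f g.
Proof.
move=> bf cg og; have bg := class_fun_bm cg; split.
  have [Y [z [g' [CY fz bg' gE]]]] := cg.
  move=> B mB; rewrite gE; split.
    by rewrite -gE; apply: measurable_preimage => //; case: bg.
  exists Y, z; split=> //; split=> //; exists (g' @^-1` B); split.
    by apply: measurable_preimage => //; case: bg'.
  by rewrite comp_preimage symdiffv measure0.
split; first exact: bm_integrable.
move=> A [mA [Y [z [CY [fz [B [mB AB]]]]]]].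
have mz : measurable_fun setT z by case: fz.
have mzB : measurable (z @^-1` B) by exact: measurable_preimage.
rewrite !integral_indic_Ex//; congr EFin.
have bA : bm (\1_A : sys_T X -> R) := bm_indic mA.
apply/eqP; rewrite eq_sym -subr_eq0 -ExB; [|exact: bmM|exact: bmM].
rewrite (eq_Ex (h := fun x => (f x - g x) * \1_A x)); last first.
  by move=> x; rewrite mulrBl.
rewrite (Ex_indic_mod0 _ mA mzB AB); last exact: bmB.
apply/eqP; apply: og; exists Y, z, (\1_B); split => //; exact: bm_indic.
Qed.

(** Orthogonality over all extensions includes the identity of [X], so one [g] gives both
    conditional expectations. *)
Lemma sated_of_nearly_optimal C (X : system) : idempotent_class C ->
  (forall f, bm f -> nearly_optimal C X f) -> sated C X.
Proof.
move=> idC nX Xt p fp f bf.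
have [g cg og] := nearly_optimal_orthogonal idC bf (nX f bf).
exists g; split; apply: cond_exp_version_orthogonal => //.
- by move=> h ch; exact: (og _ _ (factor_map_id X)).
- by case: fp => mp _; exact: bm_comp.
- exact: (class_fun_pullback fp).
- by move=> h ch; exact: og.
Qed.

End sated.

(** * The tower of extensions *)

Section tower.
Context {R : realType} {G : semigroup}.
Local Notation system := (system R G).
Local Notation bm := bounded_measurable.

Record stage := Stage {
  stage_act : nat -> @action G nat;
  stage_prob : probability (cube (nat * nat)) R;
  stage_inv : invariant_under (product_action stage_act) stage_prob }.

Definition stage_sys (S : stage) : system := cube_system (@stage_inv S).

(* All stages live on the same cube: instead of being absent, the blocks after
   the [n]-th one are copies of it. The truncations then commute everywhere, not
   only almost everywhere, as [inverse_limit_of] demands. *)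
Definition stable_after (n : nat) (S : stage) : Prop :=
  (forall k, stage_act S k = stage_act S (minn k n)) /\
  (forall A, measurable A -> stage_prob S A = stage_prob S (trunc n @^-1` A)).

(** The scheduled list may name blocks after the [n]-th, which stage [n] has not yet chosen. They
    are read as the [n]-th; once [n] is at least every block number in [s], this is the indicator of
    the cylinder. *)
Definition seen (n : nat) (s : seq (nat * nat)) (x : cube (nat * nat)) : R :=
  \1_(ones s) (trunc n x).

Lemma bm_seen n s (S : stage) : bm (X := stage_sys S) (seen n s).
Proof.
apply: (@bm_comp _ _ (stage_sys S) (stage_sys S) (trunc n) (\1_(ones s))).
  exact: trunc_measurable.
by apply: bm_indic; exact: ones_measurable.
Qed.

(** Optimality is measured against all extensions of the old stage [S]; every extension of the limit
    is among them. [next_block] records that the adjoined block lies in the maximal factor, for the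
    generation statement. *)
Record next_stage (C : system -> Prop) (n : nat) (s : seq (nat * nat))
    (S S' : stage) : Prop := NextStage {
  next_act : forall k, (k <= n)%N -> stage_act S' k = stage_act S k;
  next_stable : stable_after n.+1 S';
  next_factor : factor_map (X := stage_sys S') (Y := stage_sys S) (trunc n);
  next_opt : exists2 g, class_fun C (stage_sys S') g &
    forall (Xt : system) (p : sys_T Xt -> sys_T (stage_sys S)), factor_map p ->
    forall h, class_fun C Xt h ->
    Ex (stage_sys S') (fun x => (seen n s x - g x) ^+ 2) <=
    Ex Xt (fun x => (seen n s (p x) - h x) ^+ 2) + n.+1%:R^-1;
  next_block : forall j, max_factor C (stage_sys S')
    [set x : cube (nat * nat) | x (n.+1, j)] }.

(** [V] collects the errors attained over all extensions. A pair [Xt], [h] within [1 / (n + 1)] of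
    its infimum is chosen, and the new stage is the joint law of the old blocks and of the factor
    through which [h] is defined. *)
Lemma next_stage_exists C n s (S : stage) : idempotent_class C ->
  stable_after n S -> exists S', next_stage C n s S S'.
Proof.
move=> idC [Sa SP].
pose V := [set v : R | exists (Xt : system) (p : sys_T Xt -> sys_T (stage_sys S))
  (h : sys_T Xt -> R), [/\ factor_map p, class_fun C Xt h
    & v = Ex Xt (fun x => (seen n s (p x) - h x) ^+ 2)]].
have V0 : has_inf V.
  split; last first.
    exists 0 => _ [Xt [p [h [_ _ ->]]]].
    by apply: Ex_ge0 => x; exact: sqr_ge0.
  exists (Ex (stage_sys S) (fun x => (seen n s x - 0) ^+ 2)).
  exists (stage_sys S), (fun x => x), (fun=> 0); split => //.
  exact: class_fun_cst.
have e0 : 0 < n.+1%:R^-1 :> R by rewrite invr_gt0.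
have [_ [Xt [p [h [fp [Y [zeta [h' [CY fz bh' hE]]]] ->]]]] vlt] :=
  inf_adherent e0 V0.
have [mp [pp ep]] := fp; have [mz [pz eqz]] := fz.
pose c := coding_of Y.
(* Block [n.+1] carries the code of the new factor [Y], and the later blocks repeat it, as stability
   after [n.+1] demands. *)
pose a k := if (k <= n)%N then stage_act S k else code_act c.
pose z k w := if (k <= n)%N then block k (p w) else encode c (zeta w).
have mzk k : measurable_fun setT (z k).
  rewrite /z; case: (k <= n)%N.
    by apply: measurableT_comp => //; exact: block_measurable.
  by apply: measurableT_comp => //; exact: encode_measurable.
have ezk k g w : z k (sys_act Xt g w) = a k g (z k w).
  rewrite /z /a; case: (k <= n)%N; first by rewrite -ep.
  by rewrite -eqz encode_act.
have [P [Pa fq PE]] := push_system (glue_measurable mzk) (glue_equivariant ezk).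
pose S' := @Stage a P Pa.
have trq w : trunc n (glue z w) = trunc n (p w).
  by apply/funext => -[k j]; rewrite /trunc /glue /= /z geq_minr.
have trqS w : trunc n.+1 (glue z w) = glue z w.
  apply/funext => -[k j]; rewrite /trunc /glue /= /z.
  have [kn|nk] := leqP k n.
    by rewrite (minn_idPl (leqW kn)) kn.
  by rewrite (minn_idPr nk) ltnn.
have an k : a (minn k n) = stage_act S k by rewrite /a geq_minr -Sa.
have fb : factor_map (X := stage_sys S') (Y := Y) (decode c \o block n.+1).
  split.
    apply: (measurableT_comp (decode_measurable c)); exact: block_measurable.
  split=> [B mB|g x].
    rewrite /= PE -pz//; congr (sys_mu Xt _).
    apply/seteqP; split=> w; rewrite /= /block /glue /z /= ltnn encodeK//.
  by rewrite /= -decode_act /block /glue /= /a ltnn.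
exists S'; split.
- by move=> k kn; rewrite /= /a kn.
- split=> [k|A mA] /=.
    rewrite /a; have [kn|nk] := leqP k n.
      by rewrite (minn_idPl (leqW kn)) kn.
    by rewrite (minn_idPr nk) ltnn.
  rewrite !PE; congr (sys_mu Xt _).
  by apply/seteqP; split=> w /=; rewrite trqS.
- split; first exact: trunc_measurable.
  split=> [B mB|]; last exact: trunc_equivariant.
  (* Stability allows the law of [S] to be compared through the blocks up to [n], which are all that
     [S'] keeps of it. *)
  rewrite /= PE SP// -[RHS]pp; last first.
    by apply: (measurable_preimage (trunc_measurable n)).
  by congr (sys_mu Xt _); apply/seteqP; split=> w /=; rewrite trq.
- have cg : class_fun C (stage_sys S') (fun x => h' (decode c (block n.+1 x))).
    by exists Y, (decode c \o block n.+1), h'.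
  exists (fun x => h' (decode c (block n.+1 x))) => //.
  move=> Xt' p' fp' k ck.
  (* Lifted to [Xt], the new block decodes to [zeta], so the error on [S'] equals that of the chosen
     pair. *)
  rewrite -(@Ex_factor _ _ Xt (stage_sys S') (glue z)
    (fun x => (seen n s x - h' (decode c (block n.+1 x))) ^+ 2))//; last first.
    by apply: bm_sqr; apply: bmB; [exact: bm_seen|exact: class_fun_bm cg].
  rewrite (eq_Ex (h := fun w => (seen n s (p w) - h w) ^+ 2)); last first.
    move=> w; rewrite /seen trq hE /= /block /glue /z /= ltnn.
    by rewrite encodeK.
  apply: (le_trans (ltW vlt)); rewrite lerD2r.
  by apply: ge_inf; [case: V0|exists Xt', p', k].
- move=> j; split; first exact: coord_measurable.
  exists Y, (decode c \o block n.+1); split=> //; split=> //.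
  (* The raw bit and the bit of the re-encoded block agree on the image of [Xt]. *)
  exists [set y | encode c y j]; split.
    exact: (measurable_fun_coord _ (encode_measurable _)).
  rewrite /= PE (_ : _ @^-1` _ = set0) ?measure0//.
  apply/seteqP; split=> // w.
  by case=> -[] /=; rewrite /block /glue /z /= ltnn encodeK.
Qed.

Variables (I : countType) (i0 : I) (C : I -> system -> Prop).
Hypothesis hC : forall i, idempotent_class (C i).
Variable X0 : system.

Let c0 := coding_of X0.

Let z0 (k : nat) (x : sys_T X0) : cube nat := encode c0 x.

Let mz0 k : measurable_fun setT (z0 k).
Proof. exact: encode_measurable. Qed.

Let ez0 k g x : z0 k (sys_act X0 g x) = code_act c0 g (z0 k x).
Proof. exact: encode_act. Qed.

Let init := push_system (glue_measurable mz0)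
  (glue_equivariant (a := fun=> code_act c0) ez0).

Let stage0 : stage := Stage (s2val (projT2 init)).

Let stage0E A : stage_prob stage0 A = sys_mu X0 (glue z0 @^-1` A).
Proof. exact: (s2valP' (projT2 init)). Qed.

Let stage0_stable : stable_after 0 stage0.
Proof.
split=> // A mA; rewrite !stage0E; congr (sys_mu X0 _).
Qed.

Let stage0_factor :
  factor_map (X := stage_sys stage0) (Y := X0) (decode c0 \o block 0).
Proof.
split.
  apply: (measurableT_comp (decode_measurable c0)); exact: block_measurable.
split=> [B mB|g x]; last by rewrite /= -decode_act.
have -> : sys_mu (stage_sys stage0) = stage_prob stage0 by [].
rewrite stage0E; congr (sys_mu X0 _).
by apply/seteqP; split=> x; rewrite /= /block /glue /z0 /= encodeK.
Qed.

(** The discarded third component makes every pair recur infinitely often; [i0] serves the numbers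
    that code nothing. *)
Let schedule (n : nat) : I * seq (nat * nat) :=
  if (unpickle n : option ((I * seq (nat * nat)) * nat)) is Some q then q.1
  else (i0, [::]).

Let schedule_often i s N : exists2 n, (N <= n)%N & schedule n = (i, s).
Proof.
pose f (m : nat) : nat := pickle ((i, s), m).
have [[m Nm]|h] := pselect (exists m, (N <= f m)%N).
  by exists (f m) => //; rewrite /schedule /f pickleK.
have fN m : (f m < N)%N by rewrite ltnNge; apply/negP => Nm; apply: h; exists m.
(* Pigeonhole: [N.+1] distinct codes cannot all lie below [N]. *)
pose F (m : 'I_N.+1) : 'I_N := Ordinal (fN m).
have Finj : injective F.
  move=> m m' /(congr1 val) /= /(pcan_inj pickleK) [].
  by move=> mm'; apply: val_inj.
by have := leq_card F Finj; rewrite !card_ord ltnn.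
Qed.

Let next (n : nat) (S : {S | stable_after n S}) :
  {S' : {S' | stable_after n.+1 S'} |
   next_stage (C (schedule n).1) n (schedule n).2 (sval S) (sval S')}.
Proof.
have /cid[S' nS'] :=
  next_stage_exists (schedule n).2 (hC (schedule n).1) (svalP S).
by exists (exist _ S' (next_stable nS')).
Qed.

Let tower : forall n, {S | stable_after n S} :=
  fix tower n := match n with
  | 0%N => exist _ stage0 stage0_stable
  | n'.+1 => sval (next (tower n'))
  end.

Let S n := sval (tower n).

Let S_stable n : stable_after n (S n).
Proof. exact: svalP. Qed.

Let S_next n : next_stage (C (schedule n).1) n (schedule n).2 (S n) (S n.+1).
Proof. exact: (svalP (next (tower n))). Qed.

Let act_oo k := stage_act (S k) k.

Let S_act n k : stage_act (S n) k = act_oo (minn k n).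
Proof.
have h m : (m <= n)%N -> stage_act (S n) m = act_oo m.
  move=> mn; rewrite -(subnKC mn); elim: (n - m)%N => [|j IHj].
    by rewrite addn0.
  by rewrite addnS (next_act (S_next _)) ?leq_addr.
by rewrite (proj1 (S_stable n)) h// geq_minr.
Qed.

Lemma sated_extension : exists (X : system) (pi : sys_T X -> sys_T X0),
  [/\ factor_map pi, forall i, sated (C i) X
    & generates_mod0 X (pullback pi `|` \bigcup_i max_factor (C i) X)].
Proof.
have [n A mA|Q QE] := @projective_limit R (fun n => stage_prob (S n)).
  by have [_ [pt _]] := next_factor (S_next n); exact/esym/pt.
have Qa : invariant_under (product_action act_oo) Q.
  move=> g A mA.
  have [Q' Q'E] := push_probability Q (act_measurable (product_action act_oo) g).
  rewrite -Q'E; apply: cube_measure_unique mA => s; rewrite Q'E.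
  (* The cylinder involves only blocks up to this [n], so invariance of [Q] reduces to that of the
     law of stage [n]. *)
  pose n := (\sum_(q <- s) q.1)%N.
  have sn : trunc n @^-1` ones s = ones s.
    have le_n q : q \in s -> (q.1 <= n)%N.
      by move=> qs; rewrite /n (big_rem q)//= leq_addr.
    apply/seteqP; split=> x /allP h; apply/allP => q qs; have := h q qs;
      by rewrite /trunc (minn_idPl (le_n q qs)); case: q {qs}.
  rewrite -{1}sn.
  have -> : product_action act_oo g @^-1` (trunc n @^-1` ones s) =
      trunc n @^-1` (product_action (stage_act (S n)) g @^-1` ones s).
    have eqv x : product_action (stage_act (S n)) g (trunc n x) =
        trunc n (product_action act_oo g x).
      by apply: trunc_equivariant => k; exact: S_act.
    apply/seteqP; split=> x xs; rewrite /preimage /mkset.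
      by rewrite eqv; exact: xs.
    by rewrite -eqv; exact: xs.
  have mo := @ones_measurable (nat * nat)%type s.
  rewrite -QE; last first.
    exact: (measurable_preimage (act_measurable _ g)).
  by rewrite (stage_inv (S n))// QE// sn.
pose X := cube_system Qa.
have fX n : factor_map (X := X) (Y := stage_sys (S n)) (trunc n).
  split; first exact: trunc_measurable.
  split=> [B mB|g x]; first by rewrite /= -QE.
  by apply: trunc_equivariant => k; exact: S_act.
exists X, (decode c0 \o block 0 \o trunc 0).
have fpi := factor_map_comp (fX 0%N) stage0_factor.
split => //.
- move=> i; apply: (sated_of_nearly_optimal (hC i)).
  apply: (nearly_optimal_bounded (hC i)).
  apply: (@nearly_optimal_indic _ _ _ (hC i) X (range ones)) => //.
    exact: setI_closed_ones.
  move=> _ [s _ <-] e e0.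
  (* Beyond [N], all blocks named in [s] are present and the tolerance [1 / (n + 1)] is at most
     [e]. *)
  pose N := (\sum_(q <- s) q.1 + Num.bound e^-1)%N.
  have [n Nn sn] := schedule_often i s N.
  have le_n q : q \in s -> (q.1 <= n)%N.
    move=> qs; apply: leq_trans Nn; rewrite /N (big_rem q)//= -addnA.
    exact: leq_addr.
  have ne : n.+1%:R^-1 <= e.
    rewrite -[e]invrK lef_pV2 ?posrE ?invr_gt0//.
    apply: (@le_trans _ _ (Num.bound e^-1)%:R).
      by apply/ltW/archi_boundP; rewrite invr_ge0 ltW.
    by rewrite ler_nat leqW// (leq_trans _ Nn)// /N leq_addl.
  have seenE x : seen n s x = \1_(ones s) x.
    rewrite /seen !indicE; congr (_%:R); congr nat_of_bool.
    apply/idP/idP; rewrite !inE => /allP h; apply/allP => q qs; have := h q qs;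
      by rewrite /trunc (minn_idPl (le_n q qs)); case: q {qs}.
  have := next_opt (S_next n); rewrite sn => -[g cg gopt].
  exists (fun x => g (trunc n.+1 x)).
    exact: (class_fun_pullback (fX n.+1)).
  move=> Xt p fp h ch.
  (* An extension of the limit is one of stage [n], so the choice made at step [n] already competes
     with it. *)
  have := gopt _ _ (factor_map_comp fp (fX n)) _ ch.
  rewrite -(@Ex_factor _ _ X (stage_sys (S n.+1)) (trunc n.+1)
    (fun x => (seen n s x - g x) ^+ 2))//; last first.
    by apply: bm_sqr; apply: bmB; [exact: bm_seen|exact: class_fun_bm cg].
  have tr x : seen n s (trunc n.+1 x) = \1_(ones s) x.
    by rewrite -[RHS]seenE /seen trunc_trunc.
  have tr' x : seen n s (trunc n x) = \1_(ones s) x.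
    by rewrite -[RHS]seenE /seen trunc_trunc.
  move=> hle; apply: (@le_trans _ _
    (Ex Xt (fun x => (seen n s (trunc n (p x)) - h x) ^+ 2) + n.+1%:R^-1)).
    rewrite (le_trans _ hle)// le_eqVlt; apply/orP; left; apply/eqP.
    by apply: eq_Ex => x; rewrite tr.
  rewrite lerD// le_eqVlt; apply/orP; left; apply/eqP.
  by apply: eq_Ex => x; rewrite tr'.
move=> A mA.
(* The bits of later blocks lie in the maximal factors, null sets included. Those of block 0 are
   determined by [pi] only up to null sets, so this block alone is re-encoded. *)
pose er x := encode c0 (decode c0 (block 0 x)).
pose rho (x : sys_T X) : cube (nat * nat) :=
  fun q => if q.1 is 0%N then er x q.2 else x q.
have mer : measurable_fun setT er.
  apply: (measurableT_comp (encode_measurable c0)).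
  apply: (measurableT_comp (decode_measurable c0)); exact: block_measurable.
exists (rho @^-1` A); split.
  apply: generates_measurable_fun mA => -[[|k] j]; apply: sub_gen_smallest.
    left; exists [set y | encode c0 y j] => //.
    exact: (measurable_fun_coord _ (encode_measurable _)).
  right; exists (schedule k).1 => //.
  have := max_factor_pullback (fX k.+1) (next_block (S_next k) j).
  rewrite (_ : trunc _ @^-1` _ = [set x | rho x (k.+1, j)])//.
  by apply/seteqP; split=> x; rewrite /= /trunc /= minnn.
(* Off [D] the map [rho] is the identity. [D] depends on block 0 only, so its mass is computed at
   stage 0, where every block is a code of a point of [X0]. *)
pose D : set (cube (nat * nat)) := \bigcup_j
  symdiff [set x : cube (nat * nat) | x (0%N, j)] [set x | er x j].
have mD : measurable D.
  apply: bigcupT_measurable => j; apply: symdiff_measurable.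
    exact: coord_measurable.
  exact: (measurable_fun_coord _ mer).
have QD : Q D = 0%E.
  have -> : D = trunc 0 @^-1` D by [].
  rewrite -QE// stage0E (_ : _ @^-1` _ = set0) ?measure0//.
  apply/seteqP; split=> // x [j _ [] []] /=;
    by rewrite /er /block /glue /z0 /= encodeK.
apply/eqP; rewrite -measure_le0 -QD; apply: le_measure; rewrite ?inE//.
  apply: symdiff_measurable => //.
  apply: (measurable_preimage (f := rho)) => //.
  apply: measurable_fun_cube => -[[|k] j]; first exact: (measurable_fun_coord _ mer).
  exact: coord_measurable.
move=> x xA; apply: contrapT => xD.
have rx : rho x = x.
  apply/funext => -[[|k] j] //=; rewrite /rho /=.
  apply/idP/idP => h; apply: contrapT => h'; apply: xD; exists j => //.
    by right.
  by left.
by case: xA => -[]; rewrite /= rx.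
Qed.

End tower.

Theorem theorem2 (R : realType) (G : semigroup) (I : countType)
  (C : I -> system R G -> Prop)
  (hC : forall i, idempotent_class (C i))
  (X0 : system R G) :
  exists (X : system R G) (pi : sys_T X -> sys_T X0),
    factor_map pi /\
    (forall i, sated (C i) X) /\
    generates_mod0 X (pullback pi `|` \bigcup_i max_factor (C i) X).
Proof.
(* An empty index set offers no default for the schedule; there satedness is vacuous and the
   identity of [X0] suffices. *)
have [[i0]|nI] := pselect (inhabited I).
  by have [X [pi [fpi sX gX]]] := sated_extension i0 hC X0; exists X, pi.
exists X0, (fun x => x); split; first exact: factor_map_id.
split=> [i|A mA]; first by exfalso; apply: nI.
exists A; split; last by rewrite symdiffv measure0.
by apply: sub_gen_smallest; left; exists A.
Qed.
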